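(* Let $1<p\le q<\infty$, $\alpha>\frac12$, and let $u,v$ be weights. Then there is a constant $C>0$ such that $\|\mathscr{H}_\alpha f\|_{L_q^u}\le C\|f\|_{L_p^v}$ holds for every $f\in L_p^v$ if and only if $$\sup_{t>0}\left(\int_0^\infty\left(\frac{x^{\alpha+\frac32}}{t^{-2}+x^2}\right)^q u(x)^q\,dx\right)^{1/q}\left(\int_0^\infty\left(\frac{x^{\alpha+\frac32}}{t^2+x^2}\right)^{p'}v(x)^{-p'}\,dx\right)^{1/p'}<\infty.$$
   Context: A weight is a positive locally integrable function on $\mathbb{R}_+=(0,\infty)$. $p'$ is the Hölder conjugate of $p$. $\|f\|_{L_p^v}=\left(\int_0^\infty v(x)^p|f(x)|^p\,dx\right)^{1/p}$; $L_p^v$ is the space of measurable $f$ with $\|f\|_{L_p^v}<\infty$. The Struve function is $$\mathbf{H}_\alpha(x)=\left(\frac x2\right)^{\alpha+1}\sum_{k=0}^\infty\frac{(-1)^k(x/2)^{2k}}{\Gamma(k+3/2)\Gamma(k+\alpha+3/2)},$$ and the $\mathscr{H}_\alpha$ (Struve) transform is $\mathscr{H}_\alpha f(y)=\int_0^\infty (xy)^{1/2}f(x)\mathbf{H}_\alpha(xy)\,dx$, $y>0$. Standing assumption: functions $f$ to which the transform is applied are such that the integrand is integrable on compact subsets of $\mathbb{R}_+$ for every $y>0$ and $\lim_{N\to\infty}\int_0^N (xy)^{1/2}f(x)\mathbf{H}_\alpha(xy)\,dx$ exists and is finite for every $y>0$. *)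

(* Defs.v *)
From HB Require Import structures.
From mathcomp Require Import all_boot all_order all_algebra.
From mathcomp Require Import all_classical all_reals all_analysis.

Set Implicit Arguments.
Unset Strict Implicit.
Unset Printing Implicit Defensive.

Import Order.TTheory GRing.Theory Num.Theory.
Import numFieldNormedType.Exports.

Local Open Scope classical_set_scope.
Local Open Scope ring_scope.

(* Functions on (0, +oo) are functions R -> R whose values outside `]0, +oo[
   are never used. *)

Definition weight (R : realType) (w : R -> R) : Prop :=
  locally_integrable `]0, +oo[ w /\ forall x : R, 0 < x -> 0 < w x.

Definition conj_exp (R : realType) (p : R) : R := fine (hoelder_conjugate p%:E).

Definition wnorm (R : realType) (p : R) (w f : R -> R) : \bar R :=
  ((\int[lebesgue_measure]_(x in `]0%R, +oo[)
      (w x `^ p * `|f x| `^ p)%:E) `^ p^-1)%E.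

Definition in_wLp (R : realType) (p : R) (w f : R -> R) : Prop :=
  measurable_fun (`]0, +oo[ : set R) f /\ (wnorm p w f < +oo)%E.

(* Euler's integral, used only for s > 0. *)
Definition Gamma (R : realType) (s : R) : R :=
  \int[lebesgue_measure]_(t in `]0, +oo[) (t `^ (s - 1) * expR (- t)).

Definition struve (R : realType) (alpha x : R) : R :=
  (x / 2) `^ (alpha + 1) *
  limn (series (fun k : nat =>
    (-1) ^+ k * (x / 2) ^+ (2 * k) /
    (Gamma (k%:R + 3 / 2) * Gamma (k%:R + alpha + 3 / 2)))).

Definition struve_integrand (R : realType) (alpha : R) (f : R -> R)
    (y x : R) : R :=
  (x * y) `^ 2^-1 * f x * struve alpha (x * y).

Definition struve_partial (R : realType) (alpha : R) (f : R -> R)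
    (y N : R) : \bar R :=
  (\int[lebesgue_measure]_(x in `]0%R, N[)
     (struve_integrand alpha f y x)%:E)%E.

(* The integrals over ]0, N[ are extended-real valued, and the integral of a
   function whose positive or negative part has infinite integral is infinite
   (+oo - oo is -oo).  Hence the finite limit forces the integrand to be
   Lebesgue integrable on every ]0, N[. *)
Definition struve_dom (R : realType) (alpha : R) (f : R -> R) : Prop :=
  forall y : R, 0 < y ->
    locally_integrable `]0, +oo[ (struve_integrand alpha f y) /\
    exists l : R, struve_partial alpha f y N @[N --> +oo] --> l%:E.

(* For f in struve_dom the limit is finite, so that fine loses nothing. *)
Definition struve_transform (R : realType) (alpha : R) (f : R -> R)
    (y : R) : R :=
  fine (lim (struve_partial alpha f y N @[N --> +oo])).

(* Main.v *)
Require Import Defs.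
From HB Require Import structures.
From mathcomp Require Import all_boot all_order all_algebra.
From mathcomp Require Import all_classical all_reals all_analysis.
From mathcomp Require Import measurable_realfun ring lra.

Import Order.TTheory GRing.Theory Num.Theory.
Import numFieldNormedType.Exports.

Local Open Scope classical_set_scope.
Local Open Scope ring_scope.

(** The Struve kernel is positive and has the size of an explicit rational
kernel, and this is what makes a characterisation possible.  Put
b = alpha - 1/2 > 0.  The recurrence of the Gamma function identifies the
coefficients of the Struve series with moments of V u = 1 - u^(1/b) over [0, 1]
(a Beta integral in disguise), and summing the series under the integral sign
gives
  H_alpha(x) = L x^(alpha + 1) x^(-2) phi(x),
  phi(x) = int_0^1 (1 - cos (x sqrt (V u))) du,
with L > 0.  The integrand of phi is nonnegative, at most (x^2 V u) / 2 and at
most 2, while its oscillation cannot prevent the integral from staying away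
from 0 for large x; so phi(x) is comparable to x^2 / (1 + x^2).  With
m = alpha + 3/2 this reads (struve_kernel_bounds)
  c z^m / (1 + z^2) <= z^(1/2) H_alpha(z) <= C z^m / (1 + z^2).

Sufficiency.  Splitting the integral at x y = 1 bounds the transform of f at y
by a multiple of
  y^m int_0^(1/y) x^m |f(x)| dx + y^(m-2) int_(1/y)^oo x^(m-2) |f(x)| dx,
a sum of two Hardy operators.  Each is bounded from L_p^v to L_q^u as soon as
its Muckenhoupt condition holds (weighted_hardy), and both conditions follow
from the finiteness of the supremum, because the kernels x^m / (d + x^2) are
comparable to x^m / d where x^2 <= d and to x^(m-2) where x^2 >= d.  The Hardy
inequality itself (hardy_inequality) is proved by cutting the range of the
nondecreasing function t |-> int_{a < t} f along a geometric sequence of ratio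
2; the nested sets {a < t} are arbitrary, so that one statement serves both
operators.

Necessity.  Since 1 + x^2 y^2 <= (t^-2 + y^2) (t^2 + x^2), the kernel at x y is
at least a constant times a product of a function of x and one of y, for every t > 0.  Testing
the inequality on the function that makes Hoelder's inequality for the x-factor
an equality, truncated to sets where everything is bounded, gives a bound for
the product of the two factors which does not depend on the truncation. *)

(** * Euler's integral and its recurrence *)

Lemma powRD_gt0 (R : realType) (x r s : R) : 0 < x ->
  x `^ (r + s) = x `^ r * x `^ s.
Proof. by move=> x0; rewrite powRD//; apply/implyP => _; rewrite gt_eqF. Qed.

Section GammaFunction.
Context {R : realType}.
Implicit Types s t : R.
Notation mu := (@lebesgue_measure R).

(** The bound t / (2 a) <= exp (t / (2 a)) raised to the power a: half of the
exponential decay of the Gamma integrand absorbs the power of t. *)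
Lemma powR_le_expR_half (a t : R) : 0 < a -> 0 <= t ->
  t `^ a <= (2 * a) `^ a * expR (t / 2).
Proof.
move=> a0 t0.
have -> : expR (t / 2) = expR (t / (2 * a)) `^ a.
  by rewrite /powR gt_eqF ?expR_gt0// expRK; congr expR; field; lra.
rewrite -powRM ?expR_ge0//; last by lra.
apply: ge0_ler_powR; rewrite ?nnegrE ?mulr_ge0 ?expR_ge0//; try lra.
have := expR_ge1Dx (t / (2 * a)) => h.
rewrite -ler_pdivrMl; last lra.
by rewrite mulrC; lra.
Qed.

Lemma expRN_half_cvgy : expR (- t / 2) @[t --> +oo] --> (0 : R).
Proof.
have -> : (fun t : R => expR (- t / 2)) = (fun t => expR (- t)) \o (fun t => t / 2).
  by apply/funext => t /=; rewrite mulNr.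
apply: (@cvg_comp _ _ _ _ _ _ (+oo)); last by apply/cvgr_expR.
by apply: gt0_cvgMly => //; lra.
Qed.

Lemma integral_expRN_half :
  (\int[mu]_(t in `[0%R, +oo[) (expR (- t / 2))%:E = 2%:E)%E.
Proof.
rewrite (ge0_continuous_FTC2y (F := fun t => - 2 * expR (- t / 2)) (l := 0)).
- by rewrite oppr0 mul0r expR0 -EFinB; congr EFin; lra.
- by move=> t _; exact: expR_ge0.
- apply: continuous_subspaceT => t; apply: continuous_comp; last exact: continuous_expR.
  by apply: cvgM; [exact: cvgN|exact: cvg_cst].
- by rewrite -(mulr0 (-2)); apply: cvgM; [exact: cvg_cst|exact: expRN_half_cvgy].
- by move=> t _; apply: ex_derive.
- apply: cvg_at_right_filter.
  apply: cvgM; first exact: cvg_cst.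
  apply: continuous_comp; last exact: continuous_expR.
  by apply: cvgM; [exact: cvgN|exact: cvg_cst].
- by move=> t _; rewrite derive1E derive_val /GRing.scale /=; lra.
Qed.

Lemma powR_continuous_at (a x : R) : 0 < x -> {for x, continuous (fun t : R => t `^ a)}.
Proof.
move=> x0; apply: differentiable_continuous; apply/derivable1_diffP.
by apply: derivable_powR; rewrite in_itv/= x0.
Qed.

Lemma powR_cvg_at_right0 (a : R) : 0 < a -> x `^ a @[x --> 0^'+] --> 0 `^ a.
Proof. by move=> a0; rewrite powR0 ?gt_eqF//; exact: powR_cvg0. Qed.

Let g (a t : R) := t `^ a * expR (- t).

Lemma gamma_integrand_le (a t : R) : 0 < a -> 0 <= t ->
  g a t <= (2 * a) `^ a * expR (- t / 2).
Proof.
move=> a0 t0; have -> : - t / 2 = t / 2 + - t by lra.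
by rewrite expRD mulrA ler_wpM2r ?expR_ge0// powR_le_expR_half.
Qed.

Lemma continuous_expRN : continuous (fun t : R => expR (- t)).
Proof.
by move=> t; apply: continuous_comp; [exact: opp_continuous|exact: continuous_expR].
Qed.

Lemma gamma_integrand_continuous (a x : R) : 0 < x -> {for x, continuous (g a)}.
Proof.
move=> x0; apply: cvgM; first exact: powR_continuous_at.
exact: continuous_expRN.
Qed.

Lemma gamma_integrand_cvg0 (a : R) : 0 < a -> g a x @[x --> 0^'+] --> g a 0.
Proof.
move=> a0; apply: cvgM; first exact: powR_cvg_at_right0.
by apply: cvg_at_right_filter; exact: continuous_expRN.
Qed.

Lemma gamma_integrand_measurable (a : R) : measurable_fun setT (g a).
Proof.
apply: measurable_funM; first exact: measurable_powR.
by apply: continuous_measurable_fun; exact: continuous_expRN.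
Qed.

Lemma gamma_integrable (a : R) : 0 < a ->
  mu.-integrable `[0, +oo[ (EFin \o g a).
Proof.
move=> a0; apply/integrableP; split.
  by apply/measurable_EFinP; apply: measurable_funTS; exact: gamma_integrand_measurable.
apply: (@le_lt_trans _ _ (\int[mu]_(t in `[0%R, +oo[)
   (((2 * a) `^ a)%:E * (expR (- t / 2))%:E))%E).
  apply: ge0_le_integral => //=.
  - by apply/measurable_EFinP/measurableT_comp => //; apply: measurable_funTS;
      exact: gamma_integrand_measurable.
  - apply/measurable_EFinP; apply: measurable_funTS; apply: measurable_funM => //.
    apply: measurableT_comp; first exact: measurable_expR.
    exact: measurable_funM.
  - move=> t; rewrite in_itv/= andbT => t0.
    rewrite lee_fin ger0_norm ?gamma_integrand_le//.
    by rewrite mulr_ge0// ?powR_ge0 ?expR_ge0.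
rewrite ge0_integralZl//=.
- by rewrite integral_expRN_half -EFinM ltry.
- apply/measurable_EFinP; apply: measurable_funTS.
  apply: measurableT_comp; first exact: measurable_expR.
  exact: measurable_funM.
- by rewrite lee_fin powR_ge0.
Qed.

Lemma gamma_integrand_cvgy (a : R) : 0 < a -> g a x @[x --> +oo] --> 0.
Proof.
move=> a0; apply: (@squeeze_cvgr _ _ _ _ (cst 0)
   (fun t => (2 * a) `^ a * expR (- t / 2))).
- near=> t; have t0 : 0 <= t by near: t; apply: nbhs_pinfty_ge; rewrite num_real.
  by rewrite /= gamma_integrand_le// andbT mulr_ge0// ?powR_ge0 ?expR_ge0.
- exact: cvg_cst.
- by rewrite -[0](mulr0 ((2 * a) `^ a)); apply: cvgM; [exact: cvg_cst|exact: expRN_half_cvgy].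
Unshelve. all: end_near. Qed.

Lemma GammaE s : Gamma s = \int[mu]_(t in `[0, +oo[) g (s - 1) t.
Proof.
rewrite /Gamma /Rintegral; congr fine; apply: integral_itv_obnd_cbnd.
apply/measurable_EFinP; apply: measurable_funTS.
exact: gamma_integrand_measurable.
Qed.

(** Were the integral zero, the integrand would vanish almost everywhere on D,
against its positivity. *)
Lemma integral_gt0 (D : set R) (f : R -> \bar R) : measurable D ->
  measurable_fun D f -> (forall x, D x -> (0 < f x)%E) -> (0 < mu D)%E ->
  (0 < \int[mu]_(x in D) f x)%E.
Proof.
move=> mD mf f0 D0; rewrite lt0e integral_ge0 ?andbT; last by move=> x /f0/ltW.
apply/eqP => I0.
have : (\int[mu]_(x in D) `|f x| = 0)%E.
  by rewrite -I0; apply: eq_integral => x; rewrite inE => /f0/ltW/gee0_abs.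
move=> /(ae_eq_integral_abs mu mD mf) [N [mN N0 sub]].
suff : (mu D <= mu N)%E by rewrite N0 leNgt D0.
rewrite le_measure ?inE// => x Dx; apply: sub => /= /(_ Dx) fx0.
by have := f0 _ Dx; rewrite fx0 ltxx.
Qed.

Lemma Gamma_gt0 s : 1 < s -> 0 < Gamma s.
Proof.
move=> s1; have a0 : 0 < s - 1 by lra.
have /integrableP[m0 Ioo] := gamma_integrable _ a0.
have i0 : (0 < \int[mu]_(t in `[0%R, +oo[) (g (s - 1) t)%:E)%E.
  rewrite -integral_itv_obnd_cbnd; last first.
    by apply/measurable_EFinP; apply: measurable_funTS; exact: gamma_integrand_measurable.
  apply: integral_gt0 => //.
  - by apply/measurable_EFinP; apply: measurable_funTS; exact: gamma_integrand_measurable.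
  - move=> x; rewrite /= in_itv/= andbT => x0.
    by rewrite lte_fin mulr_gt0 ?powR_gt0 ?expR_gt0.
  - by rewrite lebesgue_measure_itv/= ltry ltry.
rewrite GammaE fine_gt0// i0/=.
apply: le_lt_trans Ioo; apply: ge0_le_integral => //=.
- by move=> x _; rewrite lee_fin mulr_ge0 ?powR_ge0 ?expR_ge0.
- by apply/measurable_EFinP/measurableT_comp => //; exact/measurable_EFinP.
- by move=> x _; rewrite lee_fin ler_norm.
Qed.

Lemma is_derive_gamma_integrand (a x : R) : 0 < x ->
  is_derive x 1 (g a) (a * g (a - 1) x - g a x).
Proof.
move=> x0.
have h := is_derive1_powR a x0.
apply: is_derive_eq.
rewrite /g /GRing.scale/=; lra.
Qed.

(** Integration by parts: s t^(s-1) e^(-t) - t^s e^(-t) is the derivative of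
t^s e^(-t), which vanishes at 0 and at infinity.  The fundamental theorem on
the unbounded interval asks for a derivative of constant sign, so the integral
is cut at t = s, where that sign changes. *)
Lemma GammaS s : 1 < s -> Gamma (s + 1) = s * Gamma s.
Proof.
move=> s1; have s0 : 0 < s by lra.
have s10 : 0 < s - 1 by lra.
pose D t := s * g (s - 1) t - g s t.
have DE t : 0 < t -> D t = t `^ (s - 1) * expR (- t) * (s - t).
  move=> t0; rewrite /D /g -(@mulr_powRB1 _ t s) ?ltW//; ring.
have cD (x : R) : 0 < x -> {for x, continuous D}.
  move=> x0; apply: cvgB; last exact: gamma_integrand_continuous.
  by apply: cvgM; [exact: cvg_cst|exact: gamma_integrand_continuous].
have ID : mu.-integrable `[0, +oo[ (EFin \o D).
  have := integrableB _ (integrableZl _ s (gamma_integrable _ s10)) (gamma_integrable _ s0).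
  exact.
have dg (x : R) : 0 < x -> derivable (g s) x 1.
  by move=> /(is_derive_gamma_integrand s)[].
have dgE (x : R) : 0 < x -> derive1 (g s) x = D x.
  by move=> /(is_derive_gamma_integrand s)[_]; rewrite derive1E.
have I1 : \int[mu]_(t in `[0, s]) D t = g s s.
  rewrite /Rintegral (continuous_FTC2 (F := g s)) //.
  - by rewrite -EFinB/= {2}/g powR0 ?gt_eqF// mul0r subr0.
  - apply/continuous_within_itvP => //; split.
    + by move=> x; rewrite in_itv/= => /andP[x0 _]; exact: cD.
    + apply: cvgB; last exact: gamma_integrand_cvg0.
      by apply: cvgM; [exact: cvg_cst|exact: gamma_integrand_cvg0].
    + by apply: cvg_at_left_filter; exact: cD.
  - split.
    + by move=> x; rewrite in_itv/= => /andP[x0 _]; exact: dg.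
    + exact: gamma_integrand_cvg0.
    + by apply: cvg_at_left_filter; exact: gamma_integrand_continuous.
  - by move=> x; rewrite in_itv/= => /andP[x0 _]; exact: dgE.
have I2 : \int[mu]_(t in `[s, +oo[) D t = - g s s.
  rewrite /Rintegral (le0_continuous_FTC2y (F := g s) (l := 0)).
  - by rewrite -EFinB/= sub0r.
  - move=> x sx; rewrite DE ?(lt_le_trans s0)// mulr_ge0_le0 ?subr_le0//.
    by rewrite mulr_ge0 ?powR_ge0 ?expR_ge0.
  - apply/continuous_within_itvcyP; split.
      by move=> x; rewrite in_itv/= andbT => sx; apply: cD; lra.
    by apply: cvg_at_right_filter; exact: cD.
  - exact: gamma_integrand_cvgy.
  - by apply: cvg_at_right_filter; exact: gamma_integrand_continuous.
  - by move=> x sx; apply: dg; lra.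
  - by move=> x; rewrite in_itv/= andbT => sx; apply: dgE; lra.
have I0 : \int[mu]_(t in `[0, +oo[) D t = 0.
  have -> : `[0, +oo[%classic = `[0, s] `|` `]s, +oo[ :> set R.
    by rewrite -itv_bndbnd_setU// bnd_simp ltW.
  have U : `[0, s] `|` `]s, +oo[ = `[0, +oo[%classic :> set R.
    by rewrite -itv_bndbnd_setU// bnd_simp ltW.
  rewrite Rintegral_setU ?U//; last first.
    by apply/disj_setPLR => x /=; rewrite !in_itv/= andbT => /andP[_ h] /(le_lt_trans h); rewrite ltxx.
  rewrite Rintegral_itv_obnd_cbnd ?I1 ?I2 ?subrr//.
  by apply: integrableS ID => //; apply: subset_itvr; rewrite bnd_simp ltW.
rewrite !GammaE addrK.
have := I0; rewrite /D RintegralB//; first last.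
- exact: gamma_integrable.
- have := integrableZl _ s (gamma_integrable _ s10); exact.
rewrite RintegralZl//; last exact: gamma_integrable.
by move=> /eqP; rewrite subr_eq0 => /eqP ->.
Qed.
End GammaFunction.

(** * A trigonometric integral behind the Struve series *)

Lemma measurable_fun_powR d (X : measurableType d) (R : realType) (D : set X)
    (f : X -> R) (a : R) :
  measurable_fun D f -> measurable_fun D (fun x => f x `^ a).
Proof.
by move=> mf; apply: (measurableT_comp (f := fun y : R => y `^ a)) mf; exact: measurable_powR.
Qed.

Lemma measurable_fun_inv d (X : measurableType d) (R : realType) (D : set X)
    (f : X -> R) :
  (forall x, D x -> 0 < f x) -> measurable_fun D f ->
  measurable_fun D (fun x => (f x)^-1).
Proof.
move=> f0 mf; apply: (eq_measurable_fun (fun x => f x `^ (-1))).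
  by move=> x; rewrite inE => /f0/ltW fx; rewrite powR_inv1.
exact: measurable_fun_powR.
Qed.

Section Struve.
Context {R : realType} (b : R).
Hypothesis b0 : 0 < b.
Notation mu := (@lebesgue_measure R).

Let V (u : R) : R := 1 - u `^ b^-1.
(** This is b B(b, k + 1) after the substitution w = u^(1/b); in the present
form the integrand is bounded whatever the value of b > 0. *)
Definition moment k : R := \int[mu]_(u in `[0, 1]) V u ^+ k.

Let V01 (u : R) : 0 <= u <= 1 -> 0 <= V u <= 1.
Proof.
move=> /andP[u0 u1]; rewrite /V subr_ge0 lerBlDr lerDl powR_ge0 andbT.
by apply: (le_trans (ge0_ler_powR _ _ _ u1)); rewrite ?powR1 ?nnegrE// invr_ge0 ltW.
Qed.

Let measurableV : measurable_fun setT V.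
Proof. by apply: measurable_funB => //; exact: measurable_powR. Qed.

Lemma cvg_exprn (F : set_system R) (FF : Filter F) (f : R -> R) (l : R) n :
  f x @[x --> F] --> l -> f x ^+ n @[x --> F] --> l ^+ n.
Proof.
move=> fl; elim: n => [|n IH]; first by under eq_fun do rewrite expr0; exact: cvg_cst.
by rewrite exprS; under eq_fun do rewrite exprS; exact: cvgM.
Qed.

Lemma integrable_bounded01 (f : R -> R) (M : R) : measurable_fun setT f ->
  (forall u, 0 <= u <= 1 -> `|f u| <= M) -> mu.-integrable `[0, 1] (EFin \o f).
Proof.
move=> mf fM; apply: measurable_bounded_integrable => //.
- by rewrite /= lebesgue_measure_itv/= lte01 ltry.
- exact: measurable_funTS.
- exists M; split; first exact: num_real.
  move=> N MN u; rewrite /= in_itv/= => /fM h; exact: (le_trans h (ltW MN)).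
Qed.

Let integrableV k : mu.-integrable `[0, 1] (EFin \o (fun u => V u ^+ k)).
Proof.
apply: (@integrable_bounded01 _ 1); first exact: measurable_funX.
by move=> u /V01/andP[v0 v1]; rewrite ger0_norm ?exprn_ge0// exprn_ile1.
Qed.

Let contV (u : R) : 0 < u -> {for u, continuous V}.
Proof. by move=> u0; apply: cvgB; [exact: cvg_cst|exact: powR_continuous_at]. Qed.

Let V_at0 : V x @[x --> 0^'+] --> V 0.
Proof.
by apply: cvgB; [exact: cvg_cst|apply: powR_cvg_at_right0; rewrite invr_gt0].
Qed.

Let within01 (f : R -> R) : (forall u, 0 < u -> {for u, continuous f}) ->
  f x @[x --> 0^'+] --> f 0 -> {within `[0, 1], continuous f}.
Proof.
move=> cf f0; apply/continuous_within_itvP => //; split => //.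
  by move=> x; rewrite in_itv/= => /andP[x0 _]; exact: cf.
by apply: cvg_at_left_filter; exact: cf.
Qed.

Lemma moment0 : moment 0 = 1.
Proof.
rewrite /moment Rintegral_cst// mul1r /= lebesgue_measure_itv/= lte01.
by rewrite oppr0 adde0.
Qed.

(** The integral over [0, 1] of the derivative of u (V u)^(k+1), a function that
vanishes at both ends; u^(1/b) = 1 - V u turns this derivative into a
combination of (V u)^(k+1) and (V u)^k. *)
Lemma momentS k : (k.+1%:R + b) * moment k.+1 = k.+1%:R * moment k.
Proof.
pose F u := u * V u ^+ k.+1.
pose f u := (1 + k.+1%:R / b) * V u ^+ k.+1 - k.+1%:R / b * V u ^+ k.
have cVn n (u : R) : 0 < u -> {for u, continuous (fun u => V u ^+ n)}.
  by move=> u0; exact: (cvg_exprn _ _ _ _ _ (contV _ u0)).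
have V0n n : V x ^+ n @[x --> 0^'+] --> V 0 ^+ n.
  exact: cvg_exprn.
have dF (u : R) : 0 < u -> is_derive u 1 F (f u).
  move=> u0; have h := is_derive1_powR b^-1 u0.
  have hV : is_derive u 1 V (- (b^-1 * u `^ (b^-1 - 1))).
    rewrite /V; apply: is_derive_eq.
    by rewrite /GRing.scale/=; ring.
  have hX : is_derive u 1 (fun u => V u ^+ k.+1) (k.+1%:R * V u ^+ k * (- (b^-1 * u `^ (b^-1 - 1)))).
    have -> : (fun u => V u ^+ k.+1) = V ^+ k.+1 by apply/funext => x; rewrite fctE.
    by apply: is_derive_eq; rewrite -mulr_natl.
  apply: is_derive_eq; rewrite /GRing.scale/=.
  have -> : u * (k.+1%:R * V u ^+ k * - (b^-1 * u `^ (b^-1 - 1)))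
    = - (k.+1%:R / b * V u ^+ k * (u * u `^ (b^-1 - 1))) by ring.
  rewrite mulr_powRB1 ?invr_gt0 ?ltW//.
  have -> : u `^ b^-1 = 1 - V u by rewrite /V; ring.
  by rewrite /f exprS; ring.
have I0 : \int[mu]_(u in `[0, 1]) f u = 0.
  rewrite /Rintegral (continuous_FTC2 (F := F)) //.
  - by rewrite -EFinB/= /F /V powR1 subrr expr0n mulr0 mul0r subr0.
  - apply: within01.
      move=> u u0; apply: cvgB; apply: cvgM; try exact: cvg_cst; exact: cVn.
    by apply: cvgB; apply: cvgM; try exact: cvg_cst; exact: V0n.
  - split.
    + by move=> x; rewrite in_itv/= => /andP[/dF[]].
    + apply: cvgM; last exact: V0n. by apply: cvg_at_right_filter; exact: cvg_id.
    + apply: cvg_at_left_filter; apply: cvgM; [exact: cvg_id|exact: cVn].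
  - by move=> x; rewrite in_itv/= => /andP[/dF[_ h] _]; rewrite derive1E.
move: I0; rewrite /f RintegralB//; first last.
- have := integrableZl _ (k.+1%:R / b) (integrableV k); exact.
- have := integrableZl _ (1 + k.+1%:R / b) (integrableV k.+1); exact.
rewrite !RintegralZl// -!/(moment _) => /eqP; rewrite subr_eq0 => /eqP h.
have bn0 : b != 0 by rewrite gt_eqF.
have -> : k.+1%:R + b = b * (1 + k.+1%:R / b) by field.
by rewrite -mulrA h; field.
Qed.

Let T (u : R) : R := Num.sqrt (V u).
(** The function phi of the Struve series: H_alpha(x) is a positive multiple of
x^(alpha + 1) x^(-2) phi(x) for b = alpha - 1/2. *)
Definition phi (x : R) : R := \int[mu]_(u in `[0, 1]) (1 - cos (x * T u)).

Let T2 (u : R) n : 0 <= u <= 1 -> T u ^+ n.*2 = V u ^+ n.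
Proof. by move=> /V01/andP[v0 _]; rewrite -mul2n exprM sqr_sqrtr. Qed.

Let measurableT : measurable_fun setT T.
Proof.
exact: (measurableT_comp (continuous_measurable_fun (@sqrt_continuous R))).
Qed.

Let integrable_phi (x : R) :
  mu.-integrable `[0, 1] (EFin \o (fun u => 1 - cos (x * T u))).
Proof.
apply: (integrable_bounded01 _ 2) => [|u _].
  apply: measurable_funB => //.
  apply: (measurableT_comp (continuous_measurable_fun (@continuous_cos R))).
  exact: measurable_funM.
by rewrite ger0_norm ?subr_ge0 ?cos_le1//; have := cos_geN1 (x * T u); lra.
Qed.

Lemma series_exp_coeff_le (x : R) n : 0 <= x -> series (exp_coeff x) n <= expR x.
Proof.
move=> x0; apply: nondecreasing_cvgn_le; last exact: is_cvg_series_exp_coeff.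
apply: nondecreasing_series => k _ _; exact: exp_coeff_ge0.
Qed.

(** The power series of 1 - cos (x T u), integrated termwise: its even powers of
T u are powers of V u, and all partial sums are dominated by exp (x^2). *)
Lemma moment_series_cvg (x : R) :
  \sum_(0 <= k < n) (-1) ^+ k * x ^+ k.+1.*2 / k.+1.*2`!%:R * moment k.+1 @[n --> \oo] --> phi x.
Proof.
pose c k : R := (-1) ^+ k * x ^+ k.+1.*2 / k.+1.*2`!%:R.
pose G n u := \sum_(0 <= k < n) c k * V u ^+ k.+1.
have mG n : measurable_fun setT (G n).
  apply: measurable_sum => k; apply: measurable_funM => //.
  exact: measurable_funX.
have cle k : `|c k| <= exp_coeff (x ^+ 2) k.+1.
  have e : x ^+ k.+1.*2 = (x ^+ 2) ^+ k.+1 by rewrite -exprM mul2n.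
  rewrite /c /exp_coeff e !normrM normrX normrN1 expr1n mul1r.
  rewrite (ger0_norm (exprn_ge0 _ (sqr_ge0 x))) /=.
  rewrite (ler_wpM2l (exprn_ge0 _ (sqr_ge0 x)))//.
  rewrite normfV normr_nat lef_pV2 ?posrE ?ltr0n ?fact_gt0// ler_nat.
  by rewrite leq_fact// -addnn leq_addr.
have Gb n u : 0 <= u <= 1 -> `|G n u| <= expR (x ^+ 2).
  move=> /V01/andP[v0 v1]; apply: le_trans (series_exp_coeff_le _ n.+1 _); last exact: sqr_ge0.
  rewrite /series/= big_nat_recl//= -[leLHS]add0r lerD ?exp_coeff_ge0 ?sqr_ge0//.
  apply: (le_trans (ler_norm_sum _ _ _)); apply: ler_sum => k _.
  rewrite normrM -[leRHS]mulr1 ler_pM//.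
  by rewrite ger0_norm ?exprn_ge0// exprn_ile1.
have Gcvg u : 0 <= u <= 1 -> G n u @[n --> \oo] --> 1 - cos (x * T u).
  move=> u01.
  have -> : (fun n => G n u) = (fun n => 1 - series (cos_coeff' (x * T u)) n.+1).
    apply/funext => n; rewrite /series/= big_nat_recl// /cos_coeff' /=.
    have -> : (-1) ^ 0%N * (x * T u) ^+ 0.*2 / (0.*2)`!%:R = 1 :> R.
      by rewrite -exprnP !expr0 mul1r divr1.
    rewrite opprD addrA subrr sub0r -sumrN.
    by apply: eq_bigr => k _; rewrite /c -T2// -exprnP exprMn exprS; ring.
  apply: cvgB; first exact: cvg_cst.
  by rewrite (cvg_shiftS (series _)); exact: cvg_cos_coeff'.
have iG n : mu.-integrable `[0, 1] (EFin \o G n).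
  by apply: (integrable_bounded01 _ (expR (x ^+ 2))) => // u; exact: Gb.
have IG n : \int[mu]_(u in `[0, 1]) G n u = \sum_(0 <= k < n) c k * moment k.+1.
  elim: n => [|n IH].
    rewrite big_nil; transitivity (\int[mu]_(u in `[0, 1]) (0 : R)).
      by apply: eq_Rintegral => u _; rewrite /G big_nil.
    by rewrite Rintegral_cst// mul0r.
  rewrite big_nat_recr//= -IH.
  transitivity (\int[mu]_(u in `[0, 1]) (G n u + c n * V u ^+ n.+1)).
    by apply: eq_Rintegral => u _; rewrite /G big_nat_recr.
  rewrite RintegralD//; last first.
    have := integrableZl _ (c n) (integrableV n.+1); exact.
  by rewrite RintegralZl.
under eq_fun do rewrite -IG.
rewrite /phi /Rintegral; apply: fine_cvg.
rewrite fineK; last exact: integrable_fin_num (integrable_phi x).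
apply: (@dominated_cvg _ _ _ mu `[0, 1]%classic _ (fun n u => (G n u)%:E)
  (fun u => (1 - cos (x * T u))%:E) (fun=> (expR (x ^+ 2))%:E)) => //=.
- by move=> n; apply/measurable_EFinP/measurable_funTS; exact: mG.
- move=> u; rewrite in_itv/= => /Gcvg h; apply: cvg_EFin => //; exact: nearW.
- by apply: (integrable_bounded01 _ (expR (x ^+ 2))) => // u _; rewrite ger0_norm ?expR_ge0.
Qed.

Lemma sin_MVT (z : R) : 0 < z -> exists2 c : R, 0 < c < z & sin z = cos c * z.
Proof.
move=> z0.
have [|c cz] := @MVT R sin cos 0 z z0 (fun x _ => is_derive_sin x).
- by apply: continuous_subspaceT => x; exact: continuous_sin.
- by rewrite sin0 !subr0 => h; exists c => //; move: cz; rewrite in_itv.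
Qed.

Lemma onem_cos_half (y : R) : 1 - cos y = 2 * sin (y / 2) ^+ 2.
Proof.
have -> : y = (y / 2) *+ 2 by rewrite -mulr_natr; field.
rewrite cos_mulr2n.
have -> : y / 2 *+ 2 / 2 = y / 2 by rewrite -mulr_natr; field.
have := cos2Dsin2 (y / 2); rewrite -mulr_natr; lra.
Qed.

Lemma onem_cos_le (y : R) : 0 <= y -> 1 - cos y <= y ^+ 2 / 2.
Proof.
rewrite le_eqVlt => /predU1P[<-|y0]; first by rewrite cos0 subrr expr0n mul0r.
rewrite onem_cos_half.
have [|c _ ->] := sin_MVT (y / 2); first lra.
have : cos c ^+ 2 <= 1 by rewrite -(cos2Dsin2 c) lerDl sqr_ge0.
have := sqr_ge0 y; nra.
Qed.

Lemma onem_cos_ge (y : R) : 0 <= y <= 1 -> cos 1 ^+ 2 / 2 * y ^+ 2 <= 1 - cos y.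
Proof.
move=> /andP[]; rewrite le_eqVlt => /predU1P[<- _|y0 y1].
  by rewrite cos0 subrr expr0n mulr0.
rewrite onem_cos_half.
have [|c /andP[c0 cy] ->] := sin_MVT (y / 2); first lra.
have h : cos 1 <= cos c.
  have p2 := pi_ge2 R.
  rewrite ltW// ltr_cos ?in_itv/=; lra.
have c1 := cos1_gt0 R.
have : cos 1 ^+ 2 <= cos c ^+ 2 by rewrite ler_sqr ?nnegrE; lra.
have := sqr_ge0 y; nra.
Qed.

Lemma phi_le (x : R) : 0 <= x -> phi x <= 4 * (x ^+ 2 / (1 + x ^+ 2)).
Proof.
move=> x0.
have h (M : R) : (forall y, 0 <= y <= x -> 1 - cos y <= M) -> phi x <= M.
  move=> hM; have -> : M = \int[mu]_(u in `[0, 1]) M.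
    by rewrite Rintegral_cst//= lebesgue_measure_itv/= lte01 oppr0 adde0 mulr1.
  apply: le_Rintegral => //.
    exact: (integrable_bounded01 _ `|M|).
  move=> u; rewrite /= in_itv/= => /V01/andP[v0 v1]; apply: hM.
  rewrite mulr_ge0 ?sqrtr_ge0//= -[leRHS]mulr1 ler_wpM2l//.
  by rewrite -sqrtr1 ler_wsqrtr.
rewrite mulrA ler_pdivlMr; last by have := sqr_ge0 x; lra.
have h1 : phi x <= 2.
  apply: h => y _; have := cos_geN1 y; lra.
have h2 : phi x <= x ^+ 2 / 2.
  apply: h => y /andP[y0 yx]; apply: (le_trans (onem_cos_le _ y0)).
  by rewrite ler_wpM2r ?invr_ge0// ler_sqr ?nnegrE.
have := sqr_ge0 x; have [|] := leP (x ^+ 2) 1; nra.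
Qed.

Let phi_ge_sub (x u1 u2 : R) : 0 <= u1 -> u2 <= 1 ->
  (\int[mu]_(u in `[u1, u2]) (1 - cos (x * T u))%:E <= (phi x)%:E)%E.
Proof.
move=> u10 u21; have ge0 u : (0 <= (1 - cos (x * T u))%:E)%E.
  by rewrite lee_fin subr_ge0 cos_le1.
rewrite /phi /Rintegral fineK; last exact: integrable_fin_num (integrable_phi x).
apply: ge0_subset_integral => //; first exact: measurable_int (integrable_phi x).
by apply: subset_itvScc; rewrite bnd_simp.
Qed.

(** For x <= 16 it suffices to integrate over the u for which
1/32 <= T u <= 1/16: there x T u <= 1 and 1 - cos (x T u) is at least a multiple
of x^2. *)
Let phi_ge_small : exists2 c : R, 0 < c & forall x, 0 <= x <= 16 -> c * x ^+ 2 <= phi x.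
Proof.
have [dl dl0 dl16] : exists2 dl : R, 0 < dl & dl * 16 = 1.
  by exists 16^-1; rewrite ?invr_gt0// mulVf.
have D0 : 0 < dl ^+ 2 by rewrite exprn_gt0.
have D1 : dl ^+ 2 < 1 by rewrite -[ltRHS](expr1n _ 2) ltr_sqr ?nnegrE; lra.
pose u1 : R := (1 - dl ^+ 2) `^ b; pose u2 : R := (1 - dl ^+ 2 / 4) `^ b.
have u12 : u1 < u2 by apply: gt0_ltr_powR => //; rewrite ?nnegrE; lra.
have u10 : 0 <= u1 by exact: powR_ge0.
have u21 : u2 <= 1.
  have -> : 1 = 1 `^ b :> R by rewrite powR1.
  apply: ge0_ler_powR; rewrite ?nnegrE ?(ltW b0)//; lra.
have c1 := cos1_gt0 R.
pose d : R := cos 1 ^+ 2 / 2 * (dl ^+ 2 / 4).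
have d0 : 0 < d by rewrite /d mulr_gt0 ?divr_gt0 ?exprn_gt0.
exists ((u2 - u1) * d) => [|x /andP[x0 x16]]; first by rewrite mulr_gt0 ?subr_gt0.
rewrite -lee_fin; apply: le_trans (phi_ge_sub x _ _ u10 u21).
have -> : (((u2 - u1) * d * x ^+ 2)%:E = \int[mu]_(u in `[u1, u2]) (d * x ^+ 2)%:E)%E.
  by rewrite integral_cst//= lebesgue_measure_itv/= lte_fin u12 -EFinB -EFinM; congr EFin; ring.
apply: ge0_le_integral => //=.
- by move=> _ _; rewrite lee_fin mulr_ge0 ?sqr_ge0// ltW.
- apply: (measurable_funS _ _ (measurable_int _ (integrable_phi x))) => //.
  by apply: subset_itvScc; rewrite bnd_simp.
- move=> u; rewrite in_itv/= => /andP[u1u uu2]; rewrite lee_fin.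
  have u0 : 0 <= u by exact: le_trans u1u.
  have pK (y : R) : 0 <= y -> (y `^ b) `^ b^-1 = y.
    by move=> y0; rewrite -powRrM mulfV ?gt_eqF// powRr1.
  have ib : 0 <= b^-1 by rewrite invr_ge0 ltW.
  have h1 : 1 - dl ^+ 2 <= u `^ b^-1.
    rewrite -[leLHS]pK; last lra.
    by apply: ge0_ler_powR; rewrite ?nnegrE.
  have h2 : u `^ b^-1 <= 1 - dl ^+ 2 / 4.
    rewrite -[leRHS]pK; last lra.
    by apply: ge0_ler_powR; rewrite ?nnegrE// powR_ge0.
  have V0 : 0 <= V u by rewrite /V; lra.
  have T0 : 0 <= T u by exact: sqrtr_ge0.
  have TV : T u ^+ 2 = V u by exact: sqr_sqrtr.
  have Tle : T u <= dl.
    by rewrite -ler_sqr ?nnegrE ?(ltW dl0)// TV /V; lra.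
  apply: le_trans (onem_cos_ge (x * T u) _); last by apply/andP; split; nra.
  rewrite exprMn TV /d -mulrA; apply: ler_wpM2l; first by rewrite divr_ge0 ?sqr_ge0.
  by rewrite mulrC; apply: ler_wpM2l; rewrite ?sqr_ge0// /V; lra.
Qed.

(** The inverse of T, used to substitute u = F t. *)
Let F (t : R) : R := (1 - t ^+ 2) `^ b.

Let TF (t : R) : 0 <= t <= 1 -> T (F t) = t.
Proof.
move=> /andP[t0 t1]; rewrite /T /V /F -powRrM mulfV ?gt_eqF// powRr1.
  by rewrite opprB addrCA subrr addr0 sqrtr_sqr ger0_norm.
by rewrite subr_ge0 -[leRHS](expr1n _ 2) ler_sqr ?nnegrE.
Qed.

Let is_derive_F (t : R) : 0 < t < 1 ->
  is_derive t 1 F (- (2 * b * t * (1 - t ^+ 2) `^ (b - 1))).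
Proof.
move=> /andP[t0 t1].
have p : 0 < 1 - t ^+ 2 by nra.
have -> : F = (fun y => y `^ b) \o (fun t => 1 - t ^+ 2) by [].
have h1 : is_derive t 1 (fun t : R => 1 - t ^+ 2) (- (2 * t)).
  have -> : (fun t : R => 1 - t ^+ 2) = cst 1 - id ^+ 2 by [].
  by apply: is_derive_eq; rewrite /GRing.scale/=; ring.
have h2 := is_derive1_powR b p.
have h3 : is_derive t 1 ((fun y => y `^ b) \o (fun t => 1 - t ^+ 2))
  ((b * (1 - t ^+ 2) `^ (b - 1)) * - (2 * t)) by exact: is_derive1_comp.
by apply: is_derive_eq; ring.
Qed.

Let f' (t : R) : R := - (2 * b * t * (1 - t ^+ 2) `^ (b - 1)).

Let derive1_F (t : R) : 0 < t < 1 -> derive1 F t = f' t.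
Proof. by move=> /is_derive_F[_ h]; rewrite derive1E h. Qed.

Let continuous_F (t : R) : 0 < t < 1 -> {for t, continuous F}.
Proof.
move=> /is_derive_F[h _].
by apply: differentiable_continuous; apply/derivable1_diffP.
Qed.

Let continuous_derive1_F (t : R) : 0 < t < 1 -> {for t, continuous (derive1 F)}.
Proof.
move=> t01; have /andP[t0 t1] := t01.
have p : 0 < 1 - t ^+ 2 by nra.
have cf : {for t, continuous f'}.
  apply: cvgN; apply: cvgM; first by apply: cvgM; [exact: cvg_cst|exact: cvg_id].
  have h : {for t, continuous (fun t : R => 1 - t ^+ 2)}.
    by apply: cvgB; [exact: cvg_cst|exact: exprn_continuous].
  exact: (continuous_comp h (powR_continuous_at (b - 1) _ p)).
rewrite /prop_for /continuous_at derive1_F//.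
apply: cvg_trans cf; apply: near_eq_cvg; near=> z.
rewrite derive1_F//; apply/andP; split; near: z; [exact: lt_nbhsr|exact: lt_nbhsl].
Unshelve. all: end_near. Qed.

Let continuous_T (u : R) : 0 < u -> {for u, continuous T}.
Proof. by move=> u0; exact: (continuous_comp (contV u u0) (@sqrt_continuous _ _)). Qed.

(** The oscillating part integrates to at most 2 / x <= 1 / 8, which is half the
length of the interval. *)
Let integral_onem_cos (x : R) : 16 <= x ->
  ((1 / 8)%:E <= \int[mu]_(t in `[(1 / 4)%R, (1 / 2)%R]) (1 - cos (x * t))%:E)%E.
Proof.
move=> x16; have x0 : x != 0 by rewrite gt_eqF//; lra.
have dmx (t : R) : is_derive t 1 (fun t => sin (x * t)) (cos (x * t) * x).
  have h : is_derive t 1 (fun t : R => x * t) x.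
    by apply: is_derive_eq; rewrite /GRing.scale/= mulr1.
  exact: (is_derive1_comp (is_derive_sin (x * t)) h).
have dG (t : R) : is_derive t 1 (fun t => t - x^-1 * sin (x * t)) (1 - cos (x * t)).
  by apply: is_derive_eq; rewrite /GRing.scale/=; field.
have cG : continuous (fun t => t - x^-1 * sin (x * t)).
  move=> t; apply: differentiable_continuous; apply/derivable1_diffP.
  by case: (dG t).
rewrite (continuous_FTC2 (F := fun t => t - x^-1 * sin (x * t))).
- rewrite -EFinB lee_fin.
  have ix : x^-1 <= 16^-1 by rewrite lef_pV2 ?posrE//; lra.
  have ix0 : 0 <= x^-1 by rewrite invr_ge0; lra.
  have := sin_le1 (x * (1 / 2)); have := sin_geN1 (x * (1 / 4)).
  set A := sin _; set B := sin _; nra.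
- lra.
- apply: continuous_subspaceT => t; apply: cvgB; first exact: cvg_cst.
  apply: (continuous_comp (f := fun t => x * t)); last exact: continuous_cos.
  by apply: cvgM; [exact: cvg_cst|exact: cvg_id].
- split; first by move=> t _; case: (dG t).
    by apply: cvg_at_right_filter; exact: cG.
  by apply: cvg_at_left_filter; exact: cG.
- by move=> t _; rewrite derive1E; case: (dG t).
Qed.

(** For x >= 16 the phase x T u need not be small.  Over the u with
1/4 <= T u <= 1/2 the substitution u = F t makes the phase linear, and the
density - F' is bounded below there, so that integral_onem_cos applies. *)
Let phi_ge_large : exists2 c : R, 0 < c & forall x, 16 <= x -> c <= phi x.
Proof.
pose k : R := b / 2 * (3 / 4) `^ b.
have k0 : 0 < k by rewrite mulr_gt0 ?divr_gt0 ?powR_gt0//; lra.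
exists (k / 8) => [|x x16]; first by rewrite divr_gt0.
have inI (t : R) : t \in `[(1 / 4), (1 / 2)] -> 1 / 4 <= t <= 1 / 2 by rewrite in_itv.
have inO (t : R) : t \in `](1 / 4), (1 / 2)[ -> 0 < t < 1.
  by rewrite in_itv/= => /andP[? ?]; apply/andP; split; lra.
have decF : {in `[(1 / 4), (1 / 2)] &, {homo F : x y /~ (x < y)%R}}.
  move=> y z /inI /andP[y1 y2] /inI /andP[z1 z2] zy.
  by apply: gt0_ltr_powR => //; rewrite ?nnegrE; nra.
have F1 : F (1 / 4) <= 1.
  rewrite [leRHS](_ : _ = 1 `^ b); last by rewrite powR1.
  apply: ge0_ler_powR; rewrite ?nnegrE ?(ltW b0)//; lra.
have F20 : 0 < F (1 / 2) by apply: powR_gt0; lra.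
rewrite -lee_fin; apply: le_trans (phi_ge_sub x _ _ (ltW F20) F1).
rewrite (@integration_by_substitution_decreasing _ F) //; first last.
- apply: continuous_in_subspaceT => u; rewrite inE/= in_itv/= => /andP[Fu _].
  have u0 : 0 < u by exact: lt_le_trans Fu.
  apply: cvgB; first exact: cvg_cst.
  apply: (continuous_comp (f := fun u => x * T u)); last exact: continuous_cos.
  by apply: cvgM; [exact: cvg_cst|exact: continuous_T].
- split.
  + by move=> t /inO/is_derive_F[].
  + by apply: cvg_at_right_filter; apply: continuous_F; lra.
  + by apply: cvg_at_left_filter; apply: continuous_F; lra.
- apply/cvg_ex; exists (derive1 F (1 / 2)).
  by apply: cvg_at_left_filter; apply: continuous_derive1_F; lra.
- apply/cvg_ex; exists (derive1 F (1 / 4)).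
  by apply: cvg_at_right_filter; apply: continuous_derive1_F; lra.
- by move=> t /inO; exact: continuous_derive1_F.
- lra.
have -> : (k / 8)%:E = (k%:E * (1 / 8)%:E)%E by rewrite -EFinM; congr EFin; field.
apply: le_trans (lee_wpmul2l _ (integral_onem_cos x x16)) _.
  by rewrite lee_fin ltW.
have mc : measurable_fun setT (fun t => 1 - cos (x * t)).
  apply: measurable_funB => //.
  apply: (measurableT_comp (continuous_measurable_fun (@continuous_cos R))).
  exact: measurable_funM.
rewrite -ge0_integralZl//=; last 2 first.
- by apply/measurable_EFinP; exact: measurable_funTS.
- by rewrite lee_fin ltW.
have -> : (\int[mu]_(t in `[(1 / 4)%R, (1 / 2)%R])
    (((fun u => 1 - cos (x * T u)) \o F) t * - derive1 F t)%:E)%E =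
  (\int[mu]_(t in `[(1 / 4)%R, (1 / 2)%R]) ((1 - cos (x * t)) * - f' t)%:E)%E.
  apply: eq_integral => t; rewrite inE/= in_itv/= => /andP[t1 t2].
  by rewrite /= TF ?derive1_F//; lra.
have m1 : measurable_fun setT (fun t : R => 1 - t ^+ 2).
  by apply: measurable_funB => //; exact: exprn_measurable.
have mf' : measurable_fun setT f'.
  apply: measurable_funN; apply: measurable_funM.
    by apply: measurable_funM.
  exact: measurable_fun_powR.
have mm : measurable_fun setT (fun t => (1 - cos (x * t)) * - f' t).
  by apply: measurable_funM => //; exact: measurable_funN.
apply: ge0_le_integral => //=.
- by move=> t _; rewrite mule_ge0// lee_fin ?subr_ge0 ?cos_le1// ltW.
- by apply: measurable_funeM; apply/measurable_EFinP; exact: measurable_funTS.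
- by apply/measurable_EFinP; exact: measurable_funTS.
- move=> t; rewrite in_itv/= => /andP[t1 t2].
  rewrite -EFinM lee_fin mulrC ler_wpM2l ?subr_ge0 ?cos_le1// /f' opprK.
  have p : 0 < 1 - t ^+ 2 by nra.
  have bt : 0 <= b * (t - 1 / 4) by rewrite mulr_ge0 ?subr_ge0// ltW.
  apply: ler_pM; [by rewrite divr_ge0// ltW|exact: powR_ge0|lra|].
  apply: (@le_trans _ _ ((1 - t ^+ 2) `^ b)).
    by apply: ge0_ler_powR; rewrite ?nnegrE ?(ltW b0)//; nra.
  by apply: ger_powR; [apply/andP; split; nra|lra].
Qed.

Lemma phi_ge : exists2 c : R, 0 < c & forall x, 0 <= x -> c * (x ^+ 2 / (1 + x ^+ 2)) <= phi x.
Proof.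
have [c1 c10 h1] := phi_ge_small; have [c2 c20 h2] := phi_ge_large.
exists (Num.min c1 c2) => [|x x0]; first by rewrite lt_min c10.
have X0 := sqr_ge0 x.
have d0 : 0 < 1 + x ^+ 2 by lra.
have m0 : 0 <= Num.min c1 c2 by rewrite le_min !ltW.
have q0 : 0 <= x ^+ 2 / (1 + x ^+ 2) by rewrite divr_ge0// ltW.
have [x16|/ltW x16] := leP x 16.
  apply: le_trans (h1 x _); last by rewrite x0.
  apply: ler_pM => //; first by rewrite ge_min lexx.
  by rewrite ler_pdivrMr//; nra.
apply: le_trans (h2 x x16); rewrite -[leRHS]mulr1.
apply: ler_pM => //; first by rewrite ge_min lexx orbT.
by rewrite ler_pdivrMr// mul1r lerDr.
Qed.

End Struve.

(** * Two-sided bounds for the Struve kernel *)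

Section StruveKernel.
Context {R : realType} (alpha : R).
Hypothesis halpha : 1 / 2 < alpha.
Let b := alpha - 1 / 2.
Let b0 : 0 < b. Proof. by rewrite /b subr_gt0. Qed.

Let coef (k : nat) : R := (Gamma (k%:R + 3 / 2) * Gamma (k%:R + alpha + 3 / 2))^-1.
Let K : R := 2 * (1 + b) * coef 0.

Let coefS k : coef k.+1 = coef k / ((k%:R + 3 / 2) * (k%:R + alpha + 3 / 2)).
Proof.
have k0 : 0 <= k%:R :> R by rewrite ler0n.
have ha := halpha.
rewrite /coef.
have -> : k.+1%:R + 3 / 2 = k%:R + 3 / 2 + 1 :> R by rewrite -natr1; ring.
have -> : k.+1%:R + alpha + 3 / 2 = k%:R + alpha + 3 / 2 + 1 :> R by rewrite -natr1; ring.
rewrite !GammaS; [|lra|lra].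
by rewrite -invfM; congr (_^-1); ring.
Qed.

Let coef_gt0 k : 0 < coef k.
Proof.
have k0 : 0 <= k%:R :> R by rewrite ler0n.
have ha := halpha.
by rewrite invr_gt0 mulr_gt0// Gamma_gt0//; lra.
Qed.

(** Both sides obey the same recurrence in k: GammaS on the left, momentS on the
right.  The half-integer shifts of the Gamma factors recombine into the
factorial (2 k + 2)!. *)
Let coefE k : coef k / 4 ^+ k = K * moment b k.+1 / k.+1.*2`!%:R.
Proof.
elim: k => [|k IH].
  have := momentS b b0 0; rewrite moment0 => h.
  have -> : 1.*2`! = 2%N by [].
  have b1 : 1 + b != 0 by rewrite gt_eqF//; have := b0; lra.
  have -> : moment b 1 = (1 + b)^-1 by apply: (mulfI b1); rewrite h divff// mulr1.
  by rewrite /K expr0 divr1; field.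
have k0 : 0 <= k%:R :> R by rewrite ler0n.
have ha := halpha.
have bp := b0.
have h := momentS b b0 k.+1.
have -> : moment b k.+2 = k.+2%:R / (k.+2%:R + b) * moment b k.+1.
  have n0 : k.+2%:R + b != 0 by rewrite gt_eqF// -[k.+2%:R]natr1 -natr1; lra.
  by apply: (mulfI n0); rewrite h mulrA mulrCA divff// mulr1.
rewrite coefS exprS.
have -> : coef k = K * moment b k.+1 / k.+1.*2`!%:R * 4 ^+ k.
  by rewrite -IH divfK// expf_neq0.
have -> : k.+2.*2`!%:R = (2 * k%:R + 4) * ((2 * k%:R + 3) * k.+1.*2`!%:R) :> R.
  have -> : k.+2.*2`! = ((2 * k + 4) * ((2 * k + 3) * k.+1.*2`!))%N.
    rewrite (doubleS k.+1) 2!factS; congr (_ * (_ * _))%N; rewrite -mul2n; ring.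
  by rewrite 2!natrM (natrD _ (2 * k) 4) (natrD _ (2 * k) 3) (natrM _ 2 k).
have f0 : k.+1.*2`!%:R != 0 :> R by rewrite pnatr_eq0 -lt0n fact_gt0.
have f4 : 4 ^+ k != 0 :> R by rewrite expf_neq0.
move: (k.+1.*2`!%:R : R) (4 ^+ k : R) (moment b k.+1) f0 f4 => f g M f0 g0.
have -> : k.+2%:R = k%:R + 2 :> R by rewrite -addn2 natrD.
move: (k%:R : R) k0 => x x0.
rewrite (_ : x + alpha + 3 / 2 = x + 2 + b); last by rewrite /b; field.
move: K b bp => L c c0.
field.
by apply/and5P; split => //; rewrite gt_eqF//; lra.
Qed.

Let term (x : R) (k : nat) : R := (-1) ^+ k * (x / 2) ^+ (2 * k) /
    (Gamma (k%:R + 3 / 2) * Gamma (k%:R + alpha + 3 / 2)).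

Let K_gt0 : 0 < K.
Proof. by have := b0 => bp; rewrite /K mulr_gt0// mulr_gt0//; lra. Qed.

(** By coefE the Struve series is, up to the factor K / x^2, the moment series of
phi. *)
Let series_term_cvg (x : R) : 0 < x ->
  series (term x) n @[n --> \oo] --> K * phi b x / x ^+ 2.
Proof.
move=> x0; have x2 : x ^+ 2 != 0 by rewrite expf_neq0// gt_eqF.
have -> : series (term x) = (fun n => K / x ^+ 2 *
   \sum_(0 <= k < n) (-1) ^+ k * x ^+ k.+1.*2 / k.+1.*2`!%:R * moment b k.+1).
  apply/funext => n; rewrite /series/= mulr_sumr; apply: eq_bigr => k _.
  rewrite /term -/(coef k).
  have -> : (x / 2) ^+ (2 * k) = x ^+ (2 * k) / 4 ^+ k.
    by rewrite expr_div_n (exprM 2) -natrX.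
  have -> : x ^+ k.+1.*2 = x ^+ 2 * x ^+ (2 * k) by rewrite -mul2n mulnS exprD.
  rewrite mulrA -[_ / 4 ^+ k * _]mulrA [_^-1 * coef k]mulrC coefE.
  have f0 : k.+1.*2`!%:R != 0 :> R by rewrite pnatr_eq0 -lt0n fact_gt0.
  move: (k.+1.*2`!%:R : R) (x ^+ (2 * k)) f0 => f X f0.
  by field; rewrite f0 gt_eqF.
rewrite [K * phi _ _ / _]mulrAC.
exact: (cvgM (cvg_cst (K / x ^+ 2)) (moment_series_cvg b b0 x)).
Qed.

Let struve_phi (x : R) : 0 < x ->
  struve alpha x = (x / 2) `^ (alpha + 1) * (K * phi b x / x ^+ 2).
Proof. by move=> x0; congr (_ * _); apply/cvg_lim => //; exact: series_term_cvg. Qed.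

Lemma measurable_struve : measurable_fun (`]0, +oo[ : set R) (struve alpha).
Proof.
apply: measurable_funM.
  apply: measurable_fun_powR; exact: measurable_funM.
apply: (measurable_fun_cvg (h := fun n x => series (term x) n)) => [n|x].
  apply: measurable_sum => k; rewrite /term.
  apply: measurable_funM => //; apply: measurable_funM => //.
  by apply: measurable_funX; exact: measurable_funM.
rewrite /= in_itv/= andbT => x0.
by apply: (cvgP _ (series_term_cvg x x0)).
Qed.

Lemma struve_kernel_bounds : exists c C : R, [/\ 0 < c, 0 < C &
  forall z, 0 < z ->
    c * (z `^ (alpha + 3 / 2) / (1 + z ^+ 2)) <= z `^ 2^-1 * struve alpha z
    <= C * (z `^ (alpha + 3 / 2) / (1 + z ^+ 2))].
Proof.
have [c c0 hc] := phi_ge b b0.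
pose L : R := (1 / 2) `^ (alpha + 1) * K.
have L0 : 0 < L by rewrite mulr_gt0// powR_gt0//; lra.
exists (L * c); exists (L * 4); split; [exact: mulr_gt0|exact: mulr_gt0|move=> z z0].
have -> : z `^ 2^-1 * struve alpha z = L * z `^ (alpha + 3 / 2) / z ^+ 2 * phi b z.
  rewrite struve_phi// /L (powRM _ (ltW z0)) ?invr_ge0//.
  have -> : alpha + 3 / 2 = 2^-1 + (alpha + 1) by field.
  rewrite (powRD_gt0 _ _ 2^-1)//.
  by rewrite div1r; ring.
have z2 : 0 < z ^+ 2 by rewrite exprn_gt0.
have d0 : 0 < 1 + z ^+ 2 by lra.
have P0 : 0 <= L * z `^ (alpha + 3 / 2) / z ^+ 2.
  by apply: divr_ge0; [apply: mulr_ge0; [exact: ltW|exact: powR_ge0]|exact: ltW].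
have -> : L * c * (z `^ (alpha + 3 / 2) / (1 + z ^+ 2)) =
    L * z `^ (alpha + 3 / 2) / z ^+ 2 * (c * (z ^+ 2 / (1 + z ^+ 2))).
  by field; rewrite !gt_eqF.
have -> : L * 4 * (z `^ (alpha + 3 / 2) / (1 + z ^+ 2)) =
    L * z `^ (alpha + 3 / 2) / z ^+ 2 * (4 * (z ^+ 2 / (1 + z ^+ 2))).
  by field; rewrite !gt_eqF.
by apply/andP; split; apply: ler_wpM2l => //; [apply: hc|apply: phi_le]; rewrite ?ltW.
Qed.

End StruveKernel.

(** * A Hardy inequality for nested families of sets *)

(** Reduces suprema over a set of reals, which may or may not be attained, to
limits of sequences.  Without a maximum, each rational with a point of B above
it contributes one such point; the sequence takes running maxima of these. *)
Lemma cofinal_sequence (R : realType) (B : set R) : B !=set0 ->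
  exists b : nat -> R, [/\ forall n, B (b n), {homo b : m n / (m <= n)%N >-> m <= n} &
    forall x, B x -> exists n, x <= b n].
Proof.
move=> [b0 Bb0].
have [[m Bm mub]|nomax] := pselect (exists2 m, B m & forall x, B x -> x <= m).
  by exists (fun=> m); split => // x Bx; exists 0%N; exact: mub.
pose above (r : rat) (b : R) := B b /\ ratr r <= b.
pose v n : R := if unpickle n is Some r then
    (if pselect (exists b, above r b) is left e then sval (cid e) else b0) else b0.
have Bv n : B (v n).
  rewrite /v; case: (unpickle n) => [r|]//.
  by case: pselect => // e; case: cid => b [].
pose w := fix w n := if n is n'.+1 then Num.max (w n') (v n) else v 0%N.
have wS n : w n <= w n.+1 by rewrite /= le_max lexx.
have vw n : v n <= w n by case: n => [|n]; rewrite ?lexx//= le_max lexx orbT.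
exists w; split.
- by elim=> [|n IH]; [exact: Bv|rewrite /= /Num.max; case: ifP].
- by apply: homo_leq => //; exact: le_trans.
- move=> x Bx; have [b Bb xb] : exists2 b, B b & x < b.
    apply: contrapT => h; apply: nomax; exists x => // y By.
    by rewrite leNgt; apply/negP => xy; apply: h; exists y.
  have [r] := rat_in_itvoo xb; rewrite in_itv/= => /andP[xr rb].
  exists (pickle r); apply: le_trans (vw _); rewrite /v pickleK.
  case: pselect => [e|]; last by case; exists b; split => //; exact: ltW.
  by case: cid => y [/= _ ry]; rewrite (le_trans _ ry)// ltW.
Qed.

(** Monotone convergence for a family of sets indexed by reals, along a sequence
cofinal in the index set. *)
Lemma integral_bigcup_nested_le d (X : measurableType d) (R : realType)
    (mu : {measure set X -> \bar R}) (F : R -> set X) (B : set R)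
    (f : X -> \bar R) (M : \bar R) :
  (forall t, measurable (F t)) -> (forall s t, s <= t -> F s `<=` F t) ->
  measurable_fun setT f -> (forall x, (0 <= f x)%E) -> (0 <= M)%E ->
  (forall t, B t -> (\int[mu]_(x in F t) f x <= M)%E) ->
  (\int[mu]_(x in \bigcup_(t in B) F t) f x <= M)%E.
Proof.
move=> mF ndF mf f0 M0 FM.
have [->|/set0P/cofinal_sequence[b [Bb ndb cofb]]] := eqVneq B set0.
  by rewrite bigcup_set0 integral_set0.
have -> : \bigcup_(t in B) F t = \bigcup_n F (b n).
  apply/seteqP; split => x [t Bt Ft]; last by exists (b t).
  by have [n tbn] := cofb t Bt; exists n => //; exact: ndF Ft.
have ndFb : nondecreasing_seq (F \o b).
  by move=> m n mn; apply/subsetPset; apply: ndF; exact: ndb.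
have cv := ge0_nondecreasing_set_cvg_integral ndFb (fun i => mF (b i))
  (fun i => measurable_funTS mf) (fun i x _ => f0 x).
rewrite -(cvg_lim _ (cv mu))//; apply: lime_le; first by apply: cvgP (cv mu).
by apply: nearW => n; exact: FM.
Qed.

Lemma sum_powR_le (R : realType) (r : R) (u : nat -> R) n : 1 <= r ->
  (forall k, 0 <= u k) ->
  \sum_(0 <= k < n) u k `^ r <= (\sum_(0 <= k < n) u k) `^ r.
Proof.
move=> r1 u0; set S := \sum_(0 <= k < n) u k.
have r0 : 0 < r by lra.
have S0 : 0 <= S by exact: sumr_ge0.
rewrite -(mulr_powRB1 S0 r0) {1}/S mulr_suml.
rewrite !big_mkord; apply: ler_sum => k _.
rewrite -(mulr_powRB1 (u0 k) r0) ler_wpM2l//.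
apply: ge0_ler_powR; rewrite ?nnegrE//; first lra.
by rewrite /S big_mkord (bigD1 k)//= lerDl sumr_ge0.
Qed.

(** G t is the integral of f over {a < t}, and hoelderP stands for Hoelder's
inequality with the weights hidden in the density P and in W.  The functions a
and c are arbitrary, so that the choices a x = x, c y = 1/y and a x = 1/x,
c y = y yield the two Hardy operators.  G may jump, so
its level sets are described by unions over t and not through points where it
takes a given value. *)
Section Hardy.
Context d d' (X : measurableType d) (Y : measurableType d') (R : realType).
Variables (mu : {measure set X -> \bar R}) (nu : {measure set Y -> \bar R}).
Variables (a : X -> R) (c : Y -> R) (f P : X -> \bar R) (U : Y -> \bar R).
Variables (G W : R -> R) (p q A I : R).
Let S t := [set x | a x < t].
Hypotheses (ma : measurable_fun setT a) (mc : measurable_fun setT c).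
Hypotheses (mf : measurable_fun setT f) (f0 : forall x, (0 <= f x)%E).
Hypotheses (mP : measurable_fun setT P) (P0 : forall x, (0 <= P x)%E).
Hypotheses (mU : measurable_fun setT U) (U0 : forall y, (0 <= U y)%E).
Hypotheses (p0 : 0 < p) (pq : p <= q) (A0 : 0 <= A).
Hypothesis GE : forall t, (\int[mu]_(x in S t) f x = (G t)%:E)%E.
Hypothesis W0 : forall t, 0 <= W t.
Hypothesis PI : (\int[mu]_x P x = I%:E)%E.
Hypothesis hoelderP : forall D t, measurable D ->
  (\int[mu]_(x in D `&` S t) f x <= ((\int[mu]_(x in D) P x) `^ p^-1 * (W t)%:E))%E.
Hypothesis muckenhoupt : forall t,
  ((W t `^ q)%:E * \int[nu]_(y in [set y | (t <= c y)%R]) U y <= A%:E)%E.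

Let q0 : 0 < q. Proof. exact: lt_le_trans pq. Qed.

Let mS t : measurable (S t).
Proof. by rewrite -[S t]setTI; apply: measurable_fun_ltr => //; exact: measurable_cst. Qed.

Let SS s t : s <= t -> S s `<=` S t.
Proof. by move=> st x /= xs; exact: lt_le_trans st. Qed.

Let G_nd : nondecreasing_fun G.
Proof.
move=> s t st; rewrite -lee_fin -!GE.
by apply: ge0_subset_integral => //; [exact: measurable_funTS|exact: SS].
Qed.

Let G0 t : 0 <= G t. Proof. by rewrite -lee_fin -GE integral_ge0. Qed.

Let mTc t : measurable [set y | t <= c y].
Proof.
by rewrite -[X in measurable X]setTI; apply: measurable_fun_ler => //; exact: measurable_cst.
Qed.

Let mGc : measurable_fun setT (G \o c).
Proof. by apply: measurableT_comp => //; exact: nondecreasing_measurable. Qed.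

Section Level.
Variable e : R.
Hypothesis e0 : 0 < e.
Let s k : R := e * 2 ^+ k.
(** The largest region of the form {a < t}, or a limit of such regions, over
which the integral of f is at most 2^k e.  It is a union over t, since the
supremum of the t with G t <= 2^k e may or may not be admissible. *)
Let N k := \bigcup_(t in [set t | G t <= s k]) S t.

Let s0 k : 0 < s k. Proof. by rewrite mulr_gt0// exprn_gt0. Qed.
Let sS k : s k.+1 = 2 * s k. Proof. by rewrite /s exprS; ring. Qed.

Let mN k : measurable (N k).
Proof.
have -> : N k = a @^-1` [set r | exists2 t, G t <= s k & r < t].
  by apply/seteqP; split => x [t h1 h2]; exists t.
rewrite -[X in measurable X]setTI; apply: ma => //.
apply: is_interval_measurable => x y /= [t1 _ _] [t2 h2 yt2] z /andP[_ zy].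
by exists t2 => //; exact: le_lt_trans yt2.
Qed.

Let NS k : N k `<=` N k.+1.
Proof.
move=> x [t tk xt]; exists t => //=; apply: le_trans tk _.
by rewrite sS; have := s0 k; lra.
Qed.

Let fN k : (\int[mu]_(x in N k) f x <= (s k)%:E)%E.
Proof.
apply: integral_bigcup_nested_le => //; first by rewrite lee_fin ltW.
by move=> t /= h; rewrite GE lee_fin.
Qed.

Let B k := N k.+1 `\` N k.
Let D k := N k.+2 `\` N k.
Let mB k : measurable (B k). Proof. exact: measurableD. Qed.
Let mD k : measurable (D k). Proof. exact: measurableD. Qed.

Let fin_int (E : set X) : measurable E -> (\int[mu]_(x in E) P x)%E \is a fin_num.
Proof.
move=> mE; rewrite ge0_fin_numE ?integral_ge0//.
by apply: (@le_lt_trans _ _ I%:E); rewrite ?ltry// -PI ge0_subset_integral.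
Qed.

Let Q k : R := fine (\int[mu]_(x in B k) P x)%E.
Let PD k : R := fine (\int[mu]_(x in D k) P x)%E.
Let Q0 k : 0 <= Q k. Proof. by rewrite fine_ge0 ?integral_ge0. Qed.
Let PD0 k : 0 <= PD k. Proof. by rewrite fine_ge0 ?integral_ge0. Qed.

Let sumQ n : \sum_(0 <= k < n) Q k <= I.
Proof.
suff h : ((\sum_(0 <= k < n) Q k)%:E <= \int[mu]_(x in N n) P x)%E.
  by rewrite -lee_fin (le_trans h)// -PI ge0_subset_integral.
elim: n => [|n IH]; first by rewrite big_nil integral_ge0.
rewrite big_nat_recr//= EFinD.
have -> : N n.+1 = N n `|` B n by rewrite /B setDUK//; exact: NS.
rewrite ge0_integral_setU//; last 2 first.
- exact: measurable_funTS.
- by apply/disj_setPS => x [h []].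
by apply: leeD => //; rewrite fineK// fin_int.
Qed.

Let PDE k : PD k = Q k + Q k.+1.
Proof.
apply: EFin_inj; rewrite EFinD !fineK ?fin_int//.
have -> : D k = B k `|` B k.+1.
  apply/seteqP; split => x.
    move=> [h1 h2]; have [h|h] := pselect (N k.+1 x); [by left|by right].
  by move=> [[h1 h2]|[h1 h2]]; split => //; [exact: NS|move=> h3; apply: h2; exact: NS].
rewrite ge0_integral_setU//; first exact: measurable_funTS.
by apply/disj_setPS => x [[h1 _] [_ h2]].
Qed.

Let sumPD n : \sum_(0 <= k < n) PD k <= 2 * I.
Proof.
have h : \sum_(0 <= k < n) PD k = \sum_(0 <= k < n) Q k + \sum_(0 <= k < n) Q k.+1.
  by rewrite -big_split; apply: eq_bigr => k _; exact: PDE.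
rewrite h mulr_natl mulr2n; apply: lerD; first exact: sumQ.
apply: le_trans (sumQ n.+1); rewrite big_nat_recl//= lerDr; exact: Q0.
Qed.

Let E k := [set y | s k.+1 < G (c y) <= s k.+2].

Let mE k : measurable (E k).
Proof.
rewrite -[E k]setTI; apply: measurable_and => //.
  by apply: measurable_fun_ltr => //; exact: measurable_cst.
by apply: measurable_fun_ler => //; exact: measurable_cst.
Qed.

(** At such y the integral over {a < c y} exceeds 2^(k+1) e, and at most half of
this comes from N k; the rest lies in N (k + 2) minus N k and is controlled by
Hoelder's inequality there. *)
Let level_le k y : E k y -> s k.+2 <= 4 * (PD k `^ p^-1 * W (c y)).
Proof.
move=> /andP[Gy1 Gy2].
have := hoelderP (D k) (c y) (mD k).
have -> : (\int[mu]_(x in D k) P x)%E = (PD k)%:E by rewrite fineK// fin_int.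
rewrite poweR_EFin -EFinM => hh.
have : ((G (c y))%:E <= (s k)%:E + \int[mu]_(x in D k `&` S (c y)) f x)%E.
  apply: (@le_trans _ _ (\int[mu]_(x in N k `|` (D k `&` S (c y))) f x)%E).
    rewrite -GE; apply: ge0_subset_integral => //.
    - by apply: measurableU => //; exact: measurableI.
    - exact: measurable_funTS.
    - move=> x xS; have [h|h] := pselect (N k x); [by left|right; split => //].
      by split => //; exists (c y).
  rewrite ge0_integral_setU//; last 3 first.
  - exact: measurableI.
  - exact: measurable_funTS.
  - by apply/disj_setPS => x [h1 [[_ h2] _]].
  exact: leeD.
move=> /le_trans /(_ (leeD2l _ hh)); rewrite -EFinD lee_fin.
by move: Gy1; rewrite !sS; lra.
Qed.

(** E k is exhausted by its parts {c >= c y} with y in E k; over each of them the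
Muckenhoupt condition at t = c y compensates the factor W (c y) of level_le. *)
Let level_int k :
  (\int[nu]_(y in E k) ((G (c y) `^ q)%:E * U y) <= ((4 `^ q * A) * PD k `^ (q / p))%:E)%E.
Proof.
set M := (_ * PD k `^ (q / p)).
have M0 : 0 <= M by rewrite !mulr_ge0 ?powR_ge0.
apply: (@le_trans _ _ (\int[nu]_(y in E k) ((s k.+2 `^ q)%:E * U y))%E).
  apply: ge0_le_integral => //=.
  - by move=> y _; rewrite mule_ge0// lee_fin powR_ge0.
  - apply: measurable_funTS; apply: emeasurable_funM => //.
    by apply/measurable_EFinP; exact: measurable_fun_powR.
  - by apply: measurable_funTS; exact: measurable_funeM.
  - move=> y /andP[_ Gy]; apply: lee_wpmul2r => //; rewrite lee_fin.
    by apply: ge0_ler_powR; rewrite ?nnegrE ?(ltW q0)// ltW.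
pose F t := E k `&` [set y | - t <= c y].
have mF t : measurable (F t) by exact: measurableI.
have -> : E k = \bigcup_(t in [set - c y | y in E k]) F t.
  apply/seteqP; split => y; last by case=> t _ [].
  by move=> Ey; exists (- c y) => /=; [exists y|split => //=; rewrite opprK].
apply: integral_bigcup_nested_le => //.
- by move=> t1 t2 t12 y [Ey /= h]; split => //=; apply: le_trans h; rewrite lerN2.
- exact: measurable_funeM.
- by move=> y; rewrite mule_ge0// lee_fin powR_ge0.
- move=> _ [y Ey <-]; rewrite ge0_integralZl//; last 2 first.
  - exact: measurable_funTS.
  - by rewrite lee_fin powR_ge0.
  apply: (@le_trans _ _ ((s k.+2 `^ q)%:E * \int[nu]_(z in [set z | (c y <= c z)%R]) U z)%E).
    rewrite lee_wpmul2l ?lee_fin ?powR_ge0//; apply: ge0_subset_integral => //.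
    - exact: measurable_funTS.
    - by move=> z [_ /=]; rewrite opprK.
  have h : s k.+2 `^ q <= 4 `^ q * PD k `^ (q / p) * W (c y) `^ q.
    have -> : 4 `^ q * PD k `^ (q / p) * W (c y) `^ q = (4 * (PD k `^ p^-1 * W (c y))) `^ q.
      by rewrite !powRM ?mulr_ge0 ?powR_ge0// mulrA -powRrM [p^-1 * q]mulrC.
    apply: ge0_ler_powR; [exact: ltW| | |exact: level_le]; rewrite nnegrE; first exact: ltW.
    by rewrite !mulr_ge0// powR_ge0.
  apply: (@le_trans _ _ ((4 `^ q * PD k `^ (q / p) * W (c y) `^ q)%:E *
      \int[nu]_(z in [set z | (c y <= c z)%R]) U z)%E).
    by rewrite lee_wpmul2r ?lee_fin// integral_ge0.
  rewrite EFinM -muleA.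
  apply: le_trans (lee_wpmul2l _ (muckenhoupt (c y))) _.
    by rewrite lee_fin mulr_ge0 ?powR_ge0.
  by rewrite -EFinM /M lee_fin mulrAC.
Qed.

Let s_nd j k : (j <= k)%N -> s j <= s k.
Proof. by move=> jk; rewrite /s ler_pM2l// ler_weXn2l// ler1n. Qed.

(** Sums level_int over k.  The exponent q / p >= 1 is taken out of the sum
(sum_powR_le), and the sets D k overlap at most twice, whence the 2 I. *)
Lemma hardy_above_level :
  (\int[nu]_(y in [set y | (s 1 < G (c y))%R]) ((G (c y) `^ q)%:E * U y)
    <= ((4 `^ q * A) * (2 * I) `^ (q / p))%:E)%E.
Proof.
have -> : [set y | s 1 < G (c y)] = \bigcup_k E k.
  apply/seteqP; split => y /=; last first.
    by move=> [k _ /andP[h _]]; apply: le_lt_trans h; exact: s_nd.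
  move=> h; have ex : exists n, G (c y) <= s n.
    exists (Num.truncn (G (c y) / e)).+1.
    rewrite /s mulrC -ler_pdivrMr//; apply: le_trans (ltW (truncnS_gt _)) _.
    by rewrite -natrX ler_nat ltnW// ltn_expl.
  case: (ex_minnP ex) => n Gn minn.
  case: n Gn minn => [|[|n]] Gn minn.
  - by have := le_lt_trans Gn (le_lt_trans (s_nd 0 1 isT) h); rewrite ltxx.
  - by have := le_lt_trans Gn h; rewrite ltxx.
  - exists n => //; apply/andP; split => //; rewrite ltNge; apply/negP => /minn.
    by rewrite ltnn.
have mg : measurable_fun setT (fun y => ((G (c y) `^ q)%:E * U y)%E).
  apply: emeasurable_funM => //.
  by apply/measurable_EFinP; exact: measurable_fun_powR.
rewrite ge0_integral_bigcup//; last 3 first.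
- exact: measurable_funTS.
- by move=> y _; rewrite mule_ge0// lee_fin powR_ge0.
- apply/trivIsetP => j k _ _ jk; wlog jk' : j k jk / (j < k)%N.
    move=> H; move: (jk); rewrite neq_ltn => /orP[]; first exact: H.
    by move=> kj; rewrite setIC; apply: H => //; rewrite eq_sym.
  apply/seteqP; split => y // [/andP[_ h1] /andP[h2 _]].
  by have := lt_le_trans h2 (le_trans h1 (s_nd j.+2 k.+1 jk')); rewrite ltxx.
have ge0 k : (0 <= \int[nu]_(y in E k) ((G (c y) `^ q)%:E * U y))%E.
  by apply: integral_ge0 => y _; rewrite mule_ge0// lee_fin powR_ge0.
apply: lime_le; first by apply: is_cvg_nneseries => n _ _; exact: ge0.
apply: nearW => n.
apply: (@le_trans _ _ (\sum_(0 <= k < n) ((4 `^ q * A) * PD k `^ (q / p))%:E)%E).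
  by apply: lee_sum => k _; exact: level_int.
rewrite sumEFin lee_fin -mulr_sumr ler_wpM2l ?mulr_ge0 ?powR_ge0//.
have r1 : 1 <= q / p by rewrite ler_pdivlMr// mul1r.
apply: le_trans (sum_powR_le R (q / p) PD n r1 PD0) _.
apply: ge0_ler_powR; rewrite ?nnegrE ?sumr_ge0//; first by apply: le_trans r1.
by apply: le_trans (sumPD n); rewrite sumr_ge0.
Qed.

End Level.

(** Lets the lowest level e tend to 0 in hardy_above_level, whose bound is the
same for all e. *)
Lemma hardy_inequality :
  (\int[nu]_y ((G (c y) `^ q)%:E * U y) <= ((4 `^ q * A) * (2 * I) `^ (q / p))%:E)%E.
Proof.
have I0 : 0 <= I by rewrite -lee_fin -PI integral_ge0.
pose F t := [set y | expR (- t) < G (c y)].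
have mg : measurable_fun setT (fun y => ((G (c y) `^ q)%:E * U y)%E).
  apply: emeasurable_funM => //.
  by apply/measurable_EFinP; exact: measurable_fun_powR.
have ge0 y : (0 <= (G (c y) `^ q)%:E * U y)%E by rewrite mule_ge0// lee_fin powR_ge0.
have -> : (\int[nu]_y ((G (c y) `^ q)%:E * U y) =
    \int[nu]_(y in \bigcup_(t in setT) F t) ((G (c y) `^ q)%:E * U y))%E.
  rewrite [RHS]integral_mkcond; apply: eq_integral => y _.
  rewrite patchE; case: ifPn => // /negP h.
  suff -> : G (c y) = 0 by rewrite powR0 ?gt_eqF// mul0e.
  apply/eqP; rewrite eq_le G0 andbT leNgt; apply/negP => Gy; apply: h.
  rewrite inE; exists (1 - ln (G (c y))) => //=.
  rewrite /F/= opprB expRD lnK ?posrE// gtr_pMr// expR_lt1; lra.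
apply: integral_bigcup_nested_le => //.
- move=> t; rewrite -[F t]setTI; apply: measurable_fun_ltr => //; exact: measurable_cst.
- by move=> t1 t2 t12 y /=; apply: le_lt_trans; rewrite ler_expR lerN2.
- by rewrite lee_fin !mulr_ge0 ?powR_ge0.
- move=> t _; have e0 : 0 < expR (- t) / 2 by rewrite divr_gt0 ?expR_gt0.
  have := hardy_above_level _ e0.
  by rewrite expr1 divfK.
Qed.

End Hardy.

(** * Weighted Hardy inequalities on the half-line *)

Lemma conj_expP (R : realType) (p : R) : 1 < p ->
  1 < conj_exp p /\ p^-1 + (conj_exp p)^-1 = 1.
Proof.
move=> p1; have p0 : p != 0 by rewrite gt_eqF//; lra.
have p10 : p - 1 != 0 by rewrite gt_eqF//; lra.
have E : conj_exp p = p / (p - 1).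
  rewrite /conj_exp /hoelder_conjugate/= ?eqe (negbTE p0) -EFinB inver (negbTE p10).
  by rewrite -EFinM.
rewrite E; split; last by field; apply/andP.
by rewrite ltr_pdivlMr; lra.
Qed.

(** Hoelder's inequality with different domains for the two factors: in the Hardy
inequality one factor is localised to a level set and the other to {a < t}. *)
Lemma hoelder_on (R : realType) d (X : measurableType d)
    (mu : {measure set X -> \bar R}) (E1 E2 : set X) (F H : X -> R) (p r : R) :
  measurable E1 -> measurable E2 -> measurable_fun E1 F -> measurable_fun E2 H ->
  0 < p -> 0 < r -> p^-1 + r^-1 = 1 ->
  (\int[mu]_(x in E1 `&` E2) (`|F x * H x|)%:E <=
   (\int[mu]_(x in E1) (`|F x| `^ p)%:E) `^ p^-1 *
   (\int[mu]_(x in E2) (`|H x| `^ r)%:E) `^ r^-1)%E.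
Proof.
move=> mE1 mE2 mF mH p0 r0 pr.
have mF' : measurable_fun setT (F \_ E1) by exact/(measurable_restrictT _ _).1.
have mH' : measurable_fun setT (H \_ E2) by exact/(measurable_restrictT _ _).1.
have := hoelder mu mF' mH' p0 r0 pr.
rewrite Lnorm1 unlock /Lnorm.
have -> : (\int[mu]_x `|((F \_ E1) \* (H \_ E2))%R x|%:E =
    \int[mu]_(x in E1 `&` E2) (`|F x * H x|)%:E)%E.
  rewrite [RHS]integral_mkcond; apply: eq_integral => x _ /=.
  rewrite !patchE in_setI.
  by case: (x \in E1) => //=; case: (x \in E2) => //=; rewrite ?mul0r ?mulr0 normr0.
have h (E : set X) (K : X -> R) (s : R) : 0 < s ->
    (\int[mu]_x (`|(K \_ E) x|%:E `^ s) = \int[mu]_(x in E) (`|K x| `^ s)%:E)%E.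
  move=> s0; rewrite [RHS]integral_mkcond; apply: eq_integral => x _ /=.
  rewrite !patchE; case: (x \in E) => //=.
  by rewrite normr0 powR0// gt_eqF.
by rewrite !h.
Qed.

Section WeightedHardy.
Context {R : realType} (p q : R) (u v : R -> R).
Notation mu := (@lebesgue_measure R).
Notation O := (`]0, +oo[%classic : set R).
Hypotheses (p1 : 1 < p) (pq : p <= q).
Hypotheses (mu_ : measurable_fun O u) (mv : measurable_fun O v).
Hypotheses (u0 : forall x : R, 0 < x -> 0 < u x) (v0 : forall x : R, 0 < x -> 0 < v x).
Let r := conj_exp p.

Let inO x : O x -> 0 < x. Proof. by rewrite /= in_itv/= andbT. Qed.

(** The instance of hardy_inequality with Lebesgue measure on both sides, where
x^m |f x| is split as (v x f x) (x^m / v x) for Hoelder's inequality.  The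
real-valued G records that the integrals over {a < t} are finite. *)
Lemma weighted_hardy (a c : R -> R) (m M : R) :
  measurable_fun setT a -> measurable_fun setT c -> 0 <= M ->
  (forall t, ((\int[mu]_(y in O `&` [set y | (t <= c y)%R]) ((y `^ m * u y) `^ q)%:E) `^ q^-1 *
    (\int[mu]_(x in O `&` [set x | (a x < t)%R]) ((x `^ m / v x) `^ r)%:E) `^ r^-1 <= M%:E)%E) ->
  (forall t, (\int[mu]_(x in O `&` [set x | (a x < t)%R]) ((x `^ m / v x) `^ r)%:E < +oo)%E) ->
  forall f : R -> R, measurable_fun O f ->
  (\int[mu]_(x in O) (v x `^ p * `|f x| `^ p)%:E < +oo)%E ->
  exists G : R -> R, [/\ forall t, 0 <= G t, measurable_fun setT (G \o c),
    forall t, (\int[mu]_(x in O `&` [set x | (a x < t)%R]) (x `^ m * `|f x|)%:E = (G t)%:E)%E &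
    (\int[mu]_(y in O) ((G (c y) * (y `^ m * u y)) `^ q)%:E <=
     ((4 * M) `^ q * (2 * fine (\int[mu]_(x in O) (v x `^ p * `|f x| `^ p)%:E)) `^ (q / p))%:E)%E].
Proof.
move=> ma mc M0 hM hfin f mf foo.
have [r1 pr] := conj_expP R p p1; rewrite -/r in r1 pr.
have p0 : 0 < p by exact: lt_trans p1.
have q0 : 0 < q by exact: lt_le_trans pq.
have r0 : 0 < r by lra.
have mS t : measurable [set x | a x < t].
  by rewrite -[X in measurable X]setTI; apply: measurable_fun_ltr => //; exact: measurable_cst.
have mO : measurable O by [].
have mpow : measurable_fun O (fun x : R => x `^ m).
  by apply: measurable_funTS; exact: measurable_powR.
have miv : measurable_fun O (fun x => (v x)^-1).
  by apply: measurable_fun_inv => // x /inO; exact: v0.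
have mH : measurable_fun O (fun x => x `^ m / v x) by exact: measurable_funM.
pose W t : R := fine ((\int[mu]_(x in O `&` [set x | (a x < t)%R]) ((x `^ m / v x) `^ r)%:E) `^ r^-1)%E.
have WE t : (W t)%:E = ((\int[mu]_(x in O `&` [set x | (a x < t)%R]) ((x `^ m / v x) `^ r)%:E) `^ r^-1)%E.
  rewrite fineK// fin_num_poweR// ge0_fin_numE//.
  by apply: integral_ge0 => x _; rewrite lee_fin powR_ge0.
have W0 t : 0 <= W t by rewrite fine_ge0// poweR_ge0.
pose I : R := fine (\int[mu]_(x in O) (v x `^ p * `|f x| `^ p)%:E).
have IE : (\int[mu]_(x in O) (v x `^ p * `|f x| `^ p)%:E = I%:E)%E.
  rewrite fineK// ge0_fin_numE//.
  by apply: integral_ge0 => x _; rewrite lee_fin mulr_ge0 ?powR_ge0.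
have mvf : measurable_fun O (fun x => v x * f x) by exact: measurable_funM.
have vfp x : 0 < x -> v x `^ p * `|f x| `^ p = `|v x * f x| `^ p.
  by move=> x0; rewrite normrM powRM// gtr0_norm// v0.
have mP : measurable_fun O (fun x => v x `^ p * `|f x| `^ p).
  apply: measurable_funM; apply: measurable_fun_powR => //.
  exact: measurableT_comp.
pose f' : R -> \bar R := (fun x => (x `^ m * `|f x|)%:E) \_ O.
pose P' : R -> \bar R := (fun x => (v x `^ p * `|f x| `^ p)%:E) \_ O.
pose U' : R -> \bar R := (fun x => ((x `^ m * u x) `^ q)%:E) \_ O.
have mf' : measurable_fun setT f'.
  apply/(measurable_restrictT _ _).1 => //; apply/measurable_EFinP.
  by apply: measurable_funM => //; exact: measurableT_comp.
have mP' : measurable_fun setT P'.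
  by apply/(measurable_restrictT _ _).1 => //; apply/measurable_EFinP.
have mU' : measurable_fun setT U'.
  apply/(measurable_restrictT _ _).1 => //; apply/measurable_EFinP.
  by apply: measurable_fun_powR; exact: measurable_funM.
have ge0 (g : R -> R) x : (forall x, 0 <= g x) -> (0 <= ((fun x => (g x)%:E) \_ O) x)%E.
  by move=> g0; rewrite patchE; case: ifP => // _; rewrite lee_fin.
have f'0 x : (0 <= f' x)%E by apply: ge0 => z; rewrite mulr_ge0 ?powR_ge0.
have P'0 x : (0 <= P' x)%E by apply: ge0 => z; rewrite mulr_ge0 ?powR_ge0.
have U'0 x : (0 <= U' x)%E by apply: ge0 => z; rewrite powR_ge0.
have hoel (D : set R) t : measurable D ->
    (\int[mu]_(x in D `&` [set x | (a x < t)%R]) f' x <=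
     (\int[mu]_(x in D) P' x) `^ p^-1 * (W t)%:E)%E.
  move=> mD; rewrite WE -!integral_mkcondr.
  have := @hoelder_on R _ _ mu (D `&` O) (O `&` [set x | a x < t])
    (fun x => v x * f x) (fun x => x `^ m / v x) p r.
  have -> : (\int[mu]_(x in (D `&` O) `&` (O `&` [set x | (a x < t)%R]))
       `|v x * f x * (x `^ m / v x)|%:E =
       \int[mu]_(x in D `&` [set x | (a x < t)%R] `&` O) (x `^ m * `|f x|)%:E)%E.
    have -> : (D `&` O) `&` (O `&` [set x | a x < t]) = D `&` [set x | a x < t] `&` O.
      by apply/seteqP; split => x; [case=> -[? ?] [? ?]|case=> -[? ?] ?]; split => //; split.
    apply: eq_integral => x; rewrite inE => -[_ /inO x0]; congr EFin.
    have vx : v x != 0 by rewrite gt_eqF// v0.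
    have -> : v x * f x * (x `^ m / v x) = x `^ m * f x by field.
    by rewrite normrM ger0_norm ?powR_ge0.
  have -> : (\int[mu]_(x in D `&` O) (`|v x * f x| `^ p)%:E =
     \int[mu]_(x in D `&` O) (v x `^ p * `|f x| `^ p)%:E)%E.
    by apply: eq_integral => x; rewrite inE => -[_ /inO x0]; rewrite vfp.
  have -> : (\int[mu]_(x in O `&` [set x | (a x < t)%R]) (`|x `^ m / v x| `^ r)%:E =
     \int[mu]_(x in O `&` [set x | (a x < t)%R]) ((x `^ m / v x) `^ r)%:E)%E.
    apply: eq_integral => x; rewrite inE => -[/inO x0 _].
    by rewrite ger0_norm// divr_ge0 ?powR_ge0 ?ltW ?v0.
  apply => //.
  - exact: measurableI.
  - exact: (measurableI _ _ mO (mS t)).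
  - by apply: (measurable_funS _ _ mvf) => // x [].
  - by apply: (measurable_funS _ _ mH) => // x [].
have PI : (\int[mu]_x P' x = I%:E)%E by rewrite -IE [RHS]integral_mkcond.
have mck t : ((W t `^ q)%:E * \int[mu]_(y in [set y | (t <= c y)%R]) U' y <= (M `^ q)%:E)%E.
  rewrite -integral_mkcondl -!poweR_EFin WE.
  set J := (X in (_ * X <= _)%E).
  have J0 : (0 <= J)%E by apply: integral_ge0 => x _; rewrite lee_fin powR_ge0.
  have -> : J = ((J `^ q^-1) `^ q)%E by rewrite -poweRrM mulVf ?gt_eqF// poweRe1.
  rewrite -poweRM ?poweR_ge0// muleC.
  apply: gt0_ler_poweR; rewrite ?in_itv/= ?leey ?andbT ?mule_ge0 ?poweR_ge0//; first exact: ltW.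
  exact: hM.
pose G t : R := fine (\int[mu]_(x in [set x | (a x < t)%R]) f' x).
have GE t : (\int[mu]_(x in [set x | (a x < t)%R]) f' x = (G t)%:E)%E.
  rewrite fineK// ge0_fin_numE ?integral_ge0//.
  have := hoel setT t measurableT; rewrite setTI PI => /le_lt_trans; apply.
  by rewrite poweR_EFin -EFinM ltry.
have G0 t : 0 <= G t by rewrite fine_ge0// integral_ge0.
exists G; split => //.
- apply: measurableT_comp => //; apply: nondecreasing_measurable => // s t st.
  rewrite -lee_fin -!GE; apply: ge0_subset_integral => //; [exact: mS|exact: mS|exact: measurable_funTS|].
  by move=> x /= xs; exact: lt_le_trans st.
- by move=> t; rewrite -GE -integral_mkcondl.
have := @hardy_inequality _ _ _ _ R mu mu a c f' P' U' G W p q (M `^ q) I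
   ma mc mf' f'0 mP' P'0 mU' U'0 p0 pq (powR_ge0 _ _) GE W0 PI hoel mck.
rewrite -powRM//.
rewrite (_ : (\int[mu]_y ((G (c y) `^ q)%:E * U' y) =
  \int[mu]_(y in O) ((G (c y) * (y `^ m * u y)) `^ q)%:E)%E) //.
rewrite [RHS]integral_mkcond; apply: eq_integral => x _.
rewrite /U' !patchE; case: ifPn; rewrite ?mule0// inE => /inO x0.
by rewrite -EFinM [in RHS]powRM// mulr_ge0 ?powR_ge0// ltW// u0.
Qed.
End WeightedHardy.

(** * The two-weight inequality *)

Lemma le_Lnorm_on (R : realType) d (X : measurableType d)
    (mu : {measure set X -> \bar R}) (E O : set X) (g h : X -> R) (k s : R) :
  measurable E -> measurable O -> E `<=` O -> measurable_fun E g ->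
  measurable_fun O h -> 0 < s -> 0 <= k ->
  (forall x, E x -> 0 <= g x <= k * h x) -> (forall x, O x -> 0 <= h x) ->
  ((\int[mu]_(x in E) (g x `^ s)%:E) `^ s^-1 <=
   k%:E * (\int[mu]_(x in O) (h x `^ s)%:E) `^ s^-1)%E.
Proof.
move=> mE mO EO mg mh s0 k0 gh h0.
have mhs : measurable_fun O (fun x => (h x `^ s)%:E).
  by apply/measurable_EFinP; exact: measurable_fun_powR.
have ip (D : set X) (f : X -> R) : (0 <= \int[mu]_(x in D) (f x `^ s)%:E)%E.
  by apply: integral_ge0 => x _; rewrite lee_fin powR_ge0.
have -> : k%:E = ((k `^ s)%:E `^ s^-1)%E.
  by rewrite poweR_EFin -powRrM mulfV ?gt_eqF// powRr1.
rewrite -poweRM ?lee_fin ?powR_ge0//.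
apply: gt0_ler_poweR; rewrite ?in_itv/= ?leey ?andbT ?mule_ge0 ?lee_fin ?powR_ge0 ?invr_ge0//; first exact: ltW.
rewrite -ge0_integralZl ?lee_fin ?powR_ge0//; last first.
  by move=> x _; rewrite lee_fin powR_ge0.
apply: (@le_trans _ _ (\int[mu]_(x in E) ((k `^ s)%:E * (h x `^ s)%:E))%E).
  apply: ge0_le_integral => //=.
  - by move=> x _; rewrite lee_fin powR_ge0.
  - by apply/measurable_EFinP; exact: measurable_fun_powR.
  - by apply: measurable_funeM; exact: measurable_funS mhs.
  - move=> x Ex; have /andP[g0 gk] := gh x Ex; have hx := h0 x (EO x Ex).
    rewrite -EFinM -powRM// lee_fin.
    by apply: ge0_ler_powR => //; rewrite ?nnegrE ?mulr_ge0//; exact: ltW.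
apply: ge0_subset_integral => //.
- exact: measurable_funeM.
- by move=> x _; rewrite mule_ge0// lee_fin powR_ge0.
Qed.

(** The integral of a nonnegative function is a supremum over simple functions
below it and so is monotone for arbitrary functions.  This matters for the
transform, of which only pointwise bounds are used. *)
Lemma le_integral_upper (R : realType) d (X : measurableType d)
    (mu : {measure set X -> \bar R}) (D : set X) (f g : X -> \bar R) :
  (forall x, D x -> (0 <= f x)%E) -> (forall x, D x -> (f x <= g x)%E) ->
  (\int[mu]_(x in D) f x <= \int[mu]_(x in D) g x)%E.
Proof.
move=> f0 fg; have g0 x : D x -> (0 <= g x)%E.
  by move=> Dx; exact: le_trans (f0 _ Dx) (fg _ Dx).
rewrite !ge0_integralE//; apply: ereal_sup_le => _ [h hf <-].
exists h => // x; apply: le_trans (hf x) _.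
by rewrite !patchE; case: ifPn => //; rewrite inE; exact: fg.
Qed.

Lemma powR_add_le (R : realType) (x y s : R) : 0 <= x -> 0 <= y -> 0 <= s ->
  (x + y) `^ s <= 2 `^ s * (x `^ s + y `^ s).
Proof.
move=> x0 y0 s0; wlog xy : x y x0 y0 / x <= y.
  move=> H; have [xy|/ltW yx] := leP x y; first exact: H.
  by rewrite addrC [x `^ s + _]addrC; exact: H.
apply: (@le_trans _ _ ((2 * y) `^ s)).
  by apply: ge0_ler_powR => //; rewrite ?nnegrE ?addr_ge0 ?mulr_ge0//; lra.
by rewrite powRM// ler_wpM2l ?powR_ge0// lerDr powR_ge0.
Qed.

Lemma integral_scaled_sum_le (R : realType) d (X : measurableType d)
    (mu : {measure set X -> \bar R}) (D : set X) (f g : X -> R) (k a b : R) :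
  measurable D -> measurable_fun D (fun x => (f x)%:E) ->
  measurable_fun D (fun x => (g x)%:E) ->
  (forall x, 0 <= f x) -> (forall x, 0 <= g x) -> 0 <= k ->
  (\int[mu]_(x in D) (f x)%:E <= a%:E)%E -> (\int[mu]_(x in D) (g x)%:E <= b%:E)%E ->
  (\int[mu]_(x in D) (k%:E * ((f x)%:E + (g x)%:E)) <= (k * (a + b))%:E)%E.
Proof.
move=> mD mf mg f0 g0 k0 fa gb; rewrite ge0_integralZl ?lee_fin//.
- rewrite ge0_integralD//; last 2 first.
  + by move=> x _; rewrite lee_fin.
  + by move=> x _; rewrite lee_fin.
  by rewrite EFinM EFinD lee_wpmul2l ?lee_fin// leeD.
- exact: emeasurable_funD.
- by move=> x _; rewrite -EFinD lee_fin addr_ge0.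
Qed.

Section TwoWeights.
Context {R : realType} (p q alpha : R) (u v : R -> R).
Notation mu := (@lebesgue_measure R).
Notation O := (`]0, +oo[%classic : set R).
Hypotheses (p1 : 1 < p) (pq : p <= q) (halpha : 1 / 2 < alpha).
Hypotheses (mu_ : measurable_fun O u) (mv : measurable_fun O v).
Hypotheses (u0 : forall x : R, 0 < x -> 0 < u x) (v0 : forall x : R, 0 < x -> 0 < v x).
Let r := conj_exp p.
Let m := alpha + 3 / 2.

Let inO x : O x -> 0 < x. Proof. by rewrite /= in_itv/= andbT. Qed.
Let p0 : 0 < p. Proof. exact: lt_trans p1. Qed.
Let q0 : 0 < q. Proof. exact: lt_le_trans pq. Qed.
Let r1 : 1 < r. Proof. by have [] := conj_expP R p p1. Qed.
Let r0 : 0 < r. Proof. exact: lt_trans r1. Qed.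

(** Either factor of the supremum: w = u and d = t^-2, or w = 1 / v and d = t^2. *)
Definition factor (w : R -> R) (s d : R) : \bar R :=
  ((\int[mu]_(x in O) ((x `^ m / (d + x ^+ 2)) `^ s * w x `^ s)%:E) `^ s^-1)%E.

Let measurable_kernel (d : R) : 0 < d ->
  measurable_fun O (fun x => x `^ m / (d + x ^+ 2)).
Proof.
move=> d0; apply: measurable_funM.
  by apply: measurable_funTS; exact: measurable_powR.
apply: measurable_fun_inv; first by move=> x _; rewrite ltr_wpDr ?sqr_ge0.
apply: measurable_funTS; apply: measurable_funD => //; exact: exprn_measurable.
Qed.

Let kernel_ge0 (d x : R) : 0 < d -> 0 <= x `^ m / (d + x ^+ 2).
Proof. by move=> d0; rewrite divr_ge0 ?powR_ge0// addr_ge0 ?sqr_ge0// ltW. Qed.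

Let kernel_gt0 (d x : R) : 0 < d -> 0 < x -> 0 < x `^ m / (d + x ^+ 2).
Proof. by move=> d0 x0; rewrite divr_gt0 ?powR_gt0// addr_gt0 ?exprn_gt0. Qed.

Let factorE (w : R -> R) (s d : R) : 0 < s -> 0 < d -> (forall x, 0 < x -> 0 < w x) ->
  factor w s d = ((\int[mu]_(x in O) ((x `^ m / (d + x ^+ 2) * w x) `^ s)%:E) `^ s^-1)%E.
Proof.
move=> s0 d0 w0; congr (_ `^ _)%E; apply: eq_integral => x; rewrite inE => /inO x0.
by rewrite (powRM _ (kernel_ge0 d x d0) (ltW (w0 x x0))).
Qed.

Lemma factor_gt0 (w : R -> R) (s d : R) : 0 < s -> 0 < d -> measurable_fun O w ->
  (forall x, 0 < x -> 0 < w x) -> (0 < factor w s d)%E.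
Proof.
move=> s0 d0 mw w0; apply: poweR_gt0; apply: integral_gt0 => //.
- apply/measurable_EFinP; apply: measurable_funM; apply: measurable_fun_powR => //.
  exact: measurable_kernel.
- by move=> x /inO x0; rewrite lte_fin mulr_gt0 ?powR_gt0 ?kernel_gt0 ?w0.
- by rewrite lebesgue_measure_itv/= ltry ltry.
Qed.

(** The passage from the factors of the supremum to the Muckenhoupt conditions:
on a set where the kernel dominates a pure power, the power replaces it. *)
Let cut_le (w : R -> R) (s d n k : R) (E : set R) : 0 < s -> 0 < d -> 0 <= k ->
  measurable_fun O w -> (forall x, 0 < x -> 0 < w x) ->
  measurable E -> E `<=` O ->
  (forall x, E x -> x `^ n <= k * (x `^ m / (d + x ^+ 2))) ->
  ((\int[mu]_(x in E) ((x `^ n * w x) `^ s)%:E) `^ s^-1 <= k%:E * factor w s d)%E.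
Proof.
move=> s0 d0 k0 mw w0 mE EO hE; rewrite factorE//.
apply: le_Lnorm_on => //.
- apply: (measurable_funS _ EO) => //; apply: measurable_funM => //.
  by apply: measurable_funTS; exact: measurable_powR.
- by apply: measurable_funM => //; exact: measurable_kernel.
- move=> x Ex; have x0 := inO x (EO x Ex); have wx := w0 x x0.
  rewrite mulr_ge0 ?powR_ge0 ?(ltW wx)//= mulrA ler_wpM2r ?(ltW wx)//; exact: hE.
- by move=> x /inO x0; rewrite mulr_ge0 ?kernel_ge0// ltW// w0.
Qed.

(** For x^2 <= d the denominator is at most 2 d; in the complementary range
(high_le) it is at most 2 x^2. *)
Let low_le (d x : R) : 0 < d -> 0 < x -> x ^+ 2 <= d ->
  x `^ m <= 2 * d * (x `^ m / (d + x ^+ 2)).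
Proof.
move=> d0 x0 xd; have P := powR_gt0 m x0; have D : 0 < d + x ^+ 2 by rewrite addr_gt0 ?exprn_gt0.
rewrite mulrA ler_pdivlMr// mulrC ler_wpM2r ?(ltW P)//; lra.
Qed.

Let high_le (d x : R) : 0 < d -> 0 < x -> d <= x ^+ 2 ->
  x `^ (m - 2) <= 2 * (x `^ m / (d + x ^+ 2)).
Proof.
move=> d0 x0 xd; have P := powR_gt0 (m - 2) x0; have D : 0 < d + x ^+ 2 by rewrite addr_gt0 ?exprn_gt0.
have -> : x `^ m = x `^ (m - 2) * x ^+ 2.
  by rewrite -powR_mulrn ?ltW// -powRD_gt0// subrK.
rewrite mulrA ler_pdivlMr// mulrCA ler_wpM2l ?(ltW P)//; lra.
Qed.

Let inv_powR (x : R) : 0 < x -> x `^ (-1) = x^-1.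
Proof. by move=> x0; rewrite powR_inv1// ltW. Qed.

Let mpow (w : R) : measurable_fun setT (fun x : R => x `^ w).
Proof. exact: measurable_powR. Qed.

Let iv (x : R) : R := (v x)^-1.
Let iv0 x : 0 < x -> 0 < iv x. Proof. by move=> x0; rewrite invr_gt0 v0. Qed.
Let miv : measurable_fun O iv.
Proof. by apply: measurable_fun_inv => // x /inO; exact: v0. Qed.

(** * Sufficiency: two Hardy operators *)

Section Sufficiency.
Variable M : R.
Hypothesis hM : forall t, 0 < t -> (factor u q (t ^- 2) * factor iv r (t ^+ 2) <= M%:E)%E.

Let t2 (t : R) : 0 < t -> 0 < t ^+ 2. Proof. by move=> t0; rewrite exprn_gt0. Qed.
Let tV2 (t : R) : 0 < t -> 0 < t ^- 2. Proof. by move=> t0; rewrite invr_gt0 exprn_gt0. Qed.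

Let M0 : 0 <= M.
Proof.
rewrite -lee_fin; apply: le_trans (hM 1 ltr01).
by rewrite mule_ge0// poweR_ge0.
Qed.

(** The factor with u is positive, so an infinite factor with v would make the
product infinite. *)
Let finB t : 0 < t -> (factor iv r (t ^+ 2) < +oo)%E.
Proof.
move=> t0; rewrite ltey; apply/eqP => By.
have := hM t t0; rewrite By gt0_muley ?factor_gt0 ?tV2//.
Qed.

Let product_le (X Y : \bar R) (k1 k2 t : R) : 0 < t -> 0 <= k1 -> 0 <= k2 -> k1 * k2 = 4 ->
  (0 <= X)%E -> (0 <= Y)%E ->
  (X <= k1%:E * factor u q (t ^- 2))%E -> (Y <= k2%:E * factor iv r (t ^+ 2))%E ->
  (X * Y <= (4 * M)%:E)%E.
Proof.
move=> t0 k10 k20 k4 X0 Y0 hX hY; apply: le_trans (lee_pmul X0 Y0 hX hY) _.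
by rewrite muleACA -EFinM k4 EFinM lee_wpmul2l ?lee_fin// hM.
Qed.

Let setI0 (a : R -> R) (t : R) : (forall x, 0 < x -> t <= a x) ->
  O `&` [set x | a x < t] = set0.
Proof.
move=> h; apply/seteqP; split => x //= [/inO/h ta at_].
by have := le_lt_trans ta at_; rewrite ltxx.
Qed.

Let mcut (a : R -> R) (t : R) : measurable_fun setT a ->
  measurable (O `&` [set x | a x < t]).
Proof.
move=> ma; apply: measurableI => //; rewrite -[X in measurable X]setTI.
by apply: measurable_fun_ltr => //; exact: measurable_cst.
Qed.

Let mcut' (a : R -> R) (t : R) : measurable_fun setT a ->
  measurable (O `&` [set x | t <= a x]).
Proof.
move=> ma; apply: measurableI => //; rewrite -[X in measurable X]setTI.
by apply: measurable_fun_ler => //; exact: measurable_cst.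
Qed.

Let low_cut t : 0 < t ->
  ((\int[mu]_(x in O `&` [set x | (x < t)%R]) ((x `^ m / v x) `^ r)%:E) `^ r^-1
   <= (2 * t ^+ 2)%:E * factor iv r (t ^+ 2))%E.
Proof.
move=> t0; apply: cut_le => //; [exact: t2|by rewrite mulr_ge0 ?sqr_ge0|exact: (mcut id)|].
- move=> x [/inO x0 /= xt]; apply: low_le => //; first exact: t2.
  by rewrite ler_sqr ?nnegrE ?ltW.
Qed.

Let high_cut t : 0 < t ->
  ((\int[mu]_(x in O `&` [set x | (x `^ (-1) < t)%R]) ((x `^ (m - 2) / v x) `^ r)%:E) `^ r^-1
   <= 2%:E * factor iv r (t^-1 ^+ 2))%E.
Proof.
move=> t0; apply: cut_le => //; [by rewrite t2 ?invr_gt0|exact: mcut|].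
- move=> x [/inO x0 /=]; rewrite inv_powR// => xt; apply: high_le => //; first by rewrite t2 ?invr_gt0.
  rewrite ler_sqr ?nnegrE ?ltW ?invr_gt0//.
  by rewrite -[ltRHS]invrK ltf_pV2 ?posrE ?invr_gt0.
Qed.

Let low_cut_u t : 0 < t ->
  ((\int[mu]_(y in O `&` [set y | (t <= y `^ (-1))%R]) ((y `^ m * u y) `^ q)%:E) `^ q^-1
   <= (2 * t ^- 2)%:E * factor u q (t ^- 2))%E.
Proof.
move=> t0; apply: cut_le => //; [exact: tV2|by rewrite mulr_ge0 ?(ltW (tV2 _ t0))|exact: mcut'|].
move=> y [/inO y0 /=]; rewrite inv_powR// => ty; apply: low_le => //; first exact: tV2.
rewrite -[leLHS]invrK lef_pV2 ?posrE ?invr_gt0 ?exprn_gt0// -exprVn.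
by apply: lerXn2r; rewrite ?nnegrE ?invr_ge0// ltW.
Qed.

Let high_cut_u t : 0 < t ->
  ((\int[mu]_(y in O `&` [set y | (t <= y)%R]) ((y `^ (m - 2) * u y) `^ q)%:E) `^ q^-1
   <= 2%:E * factor u q (t^-1 ^- 2))%E.
Proof.
move=> t0; rewrite exprVn invrK; apply: cut_le => //; [exact: t2|exact: (mcut' id)|].
move=> y [/inO y0 /= ty]; apply: high_le => //; first exact: t2.
by apply: lerXn2r; rewrite ?nnegrE// ltW.
Qed.

(** The Muckenhoupt condition of the operator integrating over x < 1/y, from the
two factors at the same t; in high_cond, for the operator integrating over
x > 1/y, the factors are taken at 1/t. *)
Let low_cond t :
  ((\int[mu]_(y in O `&` [set y | (t <= y `^ (-1))%R]) ((y `^ m * u y) `^ q)%:E) `^ q^-1 *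
   (\int[mu]_(x in O `&` [set x | (x < t)%R]) ((x `^ m / v x) `^ r)%:E) `^ r^-1 <= (4 * M)%:E)%E.
Proof.
have [t0|t0] := leP t 0.
  rewrite (setI0 id); last by move=> x x0; rewrite (le_trans t0)// ltW.
  by rewrite integral_set0 poweR0r ?invr_neq0 ?gt_eqF// mule0 lee_fin mulr_ge0.
apply: (product_le _ _ _ _ _ t0 _ _ _ _ _ (low_cut_u t t0) (low_cut t t0)); rewrite ?poweR_ge0//.
- by rewrite mulr_ge0// ltW// tV2.
- by rewrite mulr_ge0// sqr_ge0.
- by field; rewrite gt_eqF.
Qed.

Let low_fin t : (\int[mu]_(x in O `&` [set x | (x < t)%R]) ((x `^ m / v x) `^ r)%:E < +oo)%E.
Proof.
have [t0|t0] := leP t 0.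
  rewrite (setI0 id); last by move=> x x0; rewrite (le_trans t0)// ltW.
  by rewrite integral_set0 ltry.
apply: (@lty_poweRy _ _ r^-1); first by rewrite invr_neq0 ?gt_eqF.
apply: le_lt_trans (low_cut t t0) _.
by apply: lte_mul_pinfty => //; [rewrite lee_fin mulr_ge0 ?sqr_ge0|exact: finB].
Qed.

Let high_cond t :
  ((\int[mu]_(y in O `&` [set y | (t <= y)%R]) ((y `^ (m - 2) * u y) `^ q)%:E) `^ q^-1 *
   (\int[mu]_(x in O `&` [set x | (x `^ (-1) < t)%R]) ((x `^ (m - 2) / v x) `^ r)%:E) `^ r^-1 <= (4 * M)%:E)%E.
Proof.
have [t0|t0] := leP t 0.
  rewrite setI0; last by move=> x x0; rewrite (le_trans t0)// powR_ge0.
  by rewrite integral_set0 poweR0r ?invr_neq0 ?gt_eqF// mule0 lee_fin mulr_ge0.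
have ti : 0 < t^-1 by rewrite invr_gt0.
apply: (product_le _ _ _ _ _ ti _ _ _ _ _ (high_cut_u t t0) (high_cut t t0)); rewrite ?poweR_ge0//.
by rewrite -natrM.
Qed.

Let high_fin t : (\int[mu]_(x in O `&` [set x | (x `^ (-1) < t)%R]) ((x `^ (m - 2) / v x) `^ r)%:E < +oo)%E.
Proof.
have [t0|t0] := leP t 0.
  rewrite setI0; last by move=> x x0; rewrite (le_trans t0)// powR_ge0.
  by rewrite integral_set0 ltry.
apply: (@lty_poweRy _ _ r^-1); first by rewrite invr_neq0 ?gt_eqF.
apply: le_lt_trans (high_cut t t0) _.
by apply: lte_mul_pinfty => //; apply: finB; rewrite invr_gt0.
Qed.

Let M40 : 0 <= 4 * M. Proof. by rewrite mulr_ge0. Qed.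

Let mid : measurable_fun setT (id : R -> R). Proof. exact: measurable_id. Qed.

Let low_hardy := weighted_hardy p q u v p1 pq mu_ mv u0 v0 id (fun y => y `^ (-1)) m (4 * M)
  mid (mpow _) M40 low_cond low_fin.
Let high_hardy := weighted_hardy p q u v p1 pq mu_ mv u0 v0 (fun y => y `^ (-1)) id (m - 2) (4 * M)
  (mpow _) mid M40 high_cond high_fin.

Lemma sufficiency : exists2 C : R, 0 < C &
     forall f : R -> R, in_wLp p v f -> struve_dom alpha f ->
       (wnorm q u (struve_transform alpha f) <= C%:E * wnorm p v f)%E.
Proof.
have [c0 [C0 [c00 C00 hk]]] := struve_kernel_bounds alpha halpha.
pose Kq : R := 2 * (4 * (4 * M)) `^ q * 2 `^ (q / p).
have Kq0 : 0 <= Kq by rewrite !mulr_ge0 ?powR_ge0.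
pose C : R := 2 * C0 * Kq `^ q^-1.
have C_ge0 : 0 <= C by rewrite !mulr_ge0 ?powR_ge0 ?(ltW C00).
exists (C + 1) => [|f [mf fN] fdom]; first by rewrite ltr_wpDl.
have foo : (\int[mu]_(x in O) (v x `^ p * `|f x| `^ p)%:E < +oo)%E.
  by apply: (@lty_poweRy _ _ p^-1); rewrite ?invr_neq0 ?gt_eqF.
have [G1 [G10 mG1 G1E I1]] := low_hardy f mf foo.
have [G2 [G20 mG2 G2E I2]] := high_hardy f mf foo.
set I := fine _ in I1 I2.
have IE : (\int[mu]_(x in O) (v x `^ p * `|f x| `^ p)%:E = I%:E)%E.
  rewrite fineK// ge0_fin_numE//.
  by apply: integral_ge0 => x _; rewrite lee_fin mulr_ge0 ?powR_ge0.
have I0 : 0 <= I.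
  by rewrite fine_ge0// integral_ge0// => x _; rewrite lee_fin mulr_ge0 ?powR_ge0.
have pointwise y : 0 < y -> `|struve_transform alpha f y| <=
    C0 * (G1 (y `^ (-1)) * y `^ m + G2 y * y `^ (m - 2)).
  move=> y0; set B := C0 * _.
  have [[mg _ _] [l hl]] := fdom y y0.
  set g := struve_integrand alpha f y in mg.
  have mabs : measurable_fun O (fun x => `|g x|%:E).
    by apply/measurable_EFinP; exact: measurableT_comp.
  have cut E n : measurable E -> E `<=` O ->
      (forall x, E x -> (x * y) `^ m / (1 + (x * y) ^+ 2) <= (x * y) `^ n) ->
      (\int[mu]_(x in E) `|g x|%:E <=
       (C0 * y `^ n)%:E * \int[mu]_(x in E) (x `^ n * `|f x|)%:E)%E.
    move=> mE EO hn.
    have mh : measurable_fun E (fun x => (x `^ n * `|f x|)%:E).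
      apply/measurable_EFinP; apply: (measurable_funS _ EO) => //; apply: measurable_funM.
        by apply: measurable_funTS; exact: mpow.
      exact: measurableT_comp.
    rewrite -ge0_integralZl//; last 2 first.
    - by move=> x _; rewrite lee_fin mulr_ge0 ?powR_ge0.
    - by rewrite lee_fin mulr_ge0 ?powR_ge0// ltW.
    apply: le_integral_upper => x Ex; first by rewrite lee_fin.
    have x0 := inO x (EO x Ex); have xy0 : 0 < x * y by exact: mulr_gt0.
    have /andP[h1 h2] := hk (x * y) xy0.
    have -> : g x = (x * y) `^ 2^-1 * struve alpha (x * y) * f x.
      by rewrite /g /struve_integrand mulrAC.
    move: ((x * y) `^ 2^-1 * _) h1 h2 => k h1 h2.
    have k0 : 0 <= k.
      apply: le_trans h1; rewrite mulr_ge0 ?(ltW c00)// divr_ge0 ?powR_ge0//.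
      by rewrite addr_ge0 ?sqr_ge0.
    rewrite -EFinM lee_fin normrM (ger0_norm k0) mulrA.
    apply: ler_wpM2r => //; apply: le_trans h2 _.
    rewrite -mulrA [y `^ n * _]mulrC -(powRM _ (ltW x0) (ltW y0)).
    by apply: ler_wpM2l; [exact: ltW|exact: hn].
  have hB : (\int[mu]_(x in O) `|g x|%:E <= B%:E)%E.
    (* At x y = 1 the kernel bound passes from the power m to the power m - 2. *)
    have y1 : 0 < y^-1 by rewrite invr_gt0.
    have OE : O = `]0, y^-1[%classic `|` `[y^-1, +oo[%classic.
      by rewrite -itv_bndbnd_setU// bnd_simp.
    rewrite OE ge0_integral_setU//; last 2 first.
    - by rewrite -OE.
    - apply/disj_setPS => x [/=]; rewrite !in_itv/= andbT => /andP[_ h1] /(lt_le_trans h1).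
      by rewrite ltxx.
    rewrite /B mulrDr EFinD; apply: leeD.
      rewrite [C0 * _]mulrA [C0 * _ * _]mulrAC EFinM -G1E.
      have -> : O `&` [set x | x < y `^ (-1)] = `]0, y^-1[%classic.
        rewrite inv_powR//; apply/seteqP; split => x /=; rewrite !in_itv/= ?andbT.
          by move=> [-> ->].
        by move=> /andP[].
      apply: cut => //.
        by move=> x /=; rewrite !in_itv/= => /andP[->].
      move=> x /=; rewrite in_itv/= => /andP[x0 xy].
      rewrite ler_pdivrMr; last by rewrite ltr_wpDr ?sqr_ge0.
      by rewrite mulrDr mulr1 lerDl mulr_ge0 ?powR_ge0 ?sqr_ge0.
    rewrite -integral_itv_obnd_cbnd; last first.
      apply: (measurable_funS _ _ mabs) => // x /=; rewrite !in_itv/= !andbT.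
      exact: lt_trans.
    rewrite [C0 * _]mulrA [C0 * _ * _]mulrAC EFinM -G2E.
    have -> : O `&` [set x | x `^ (-1) < y] = `]y^-1, +oo[%classic.
      apply/seteqP; split => x /=; rewrite !in_itv/= !andbT.
        move=> [x0]; rewrite inv_powR// => xy.
        by rewrite -[ltRHS]invrK ltf_pV2 ?posrE ?invr_gt0.
      move=> yx; have x0 : 0 < x by exact: lt_trans yx.
      by split => //; rewrite inv_powR// -[ltRHS]invrK ltf_pV2 ?posrE ?invr_gt0.
    apply: cut => //.
      by move=> x /=; rewrite !in_itv/= !andbT; exact: lt_trans.
    move=> x /=; rewrite in_itv/= andbT => yx.
    have x0 : 0 < x by exact: lt_trans yx.
    have z0 : 0 < x * y by exact: mulr_gt0.
    rewrite ler_pdivrMr; last by rewrite ltr_wpDr ?sqr_ge0.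
    have -> : (x * y) `^ m = (x * y) `^ (m - 2) * (x * y) ^+ 2.
      by rewrite -powR_mulrn ?(ltW z0)// -powRD_gt0// subrK.
    by rewrite ler_wpM2l ?powR_ge0// lerDr.
  have hl' : (`|l|%:E <= B%:E)%E.
    apply: (cvge_to_le (cvg_abse hl)); apply: nearW => N.
    have mN : measurable_fun `]0, N[ g.
      apply: (measurable_funS _ _ mg) => // x /=.
      by rewrite !in_itv/= => /andP[->].
    apply: le_trans (le_abse_integral _ _ _) _ => //; first exact/measurable_EFinP.
    apply: le_trans hB; apply: ge0_subset_integral => //.
    by move=> x /=; rewrite !in_itv/= => /andP[->].
  by rewrite /struve_transform (cvg_lim _ hl)//= -lee_fin.
have wE : wnorm p v f = (I `^ p^-1)%:E by rewrite /wnorm IE poweR_EFin.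
have wC : (C%:E * wnorm p v f <= (C + 1)%:E * wnorm p v f)%E.
  by apply: lee_wpmul2r; rewrite ?poweR_ge0// lee_fin lerDl.
apply: le_trans wC; rewrite wE -EFinM.
pose a1 y := G1 (y `^ (-1)) * (y `^ m * u y).
pose a2 y := G2 y * (y `^ (m - 2) * u y).
have mpu n : measurable_fun O (fun y => y `^ n * u y).
  by apply: measurable_funM => //; apply: measurable_funTS; exact: mpow.
have ma1 : measurable_fun O (fun y => (a1 y `^ q)%:E).
  apply/measurable_EFinP; apply: measurable_fun_powR; apply: measurable_funM => //.
  exact: measurable_funTS.
have ma2 : measurable_fun O (fun y => (a2 y `^ q)%:E).
  apply/measurable_EFinP; apply: measurable_fun_powR; apply: measurable_funM => //.
  exact: measurable_funTS.
have a10 y : 0 < y -> 0 <= a1 y.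
  by move=> y0; rewrite !mulr_ge0 ?powR_ge0 ?(ltW (u0 _ y0)).
have a20 y : 0 < y -> 0 <= a2 y.
  by move=> y0; rewrite !mulr_ge0 ?powR_ge0 ?(ltW (u0 _ y0)).
have key : (\int[mu]_(y in O) (u y `^ q * `|struve_transform alpha f y| `^ q)%:E <=
    ((2 * C0) `^ q * (Kq * I `^ (q / p)))%:E)%E.
  apply: (@le_trans _ _ (\int[mu]_(y in O)
      (((2 * C0) `^ q)%:E * ((a1 y `^ q)%:E + (a2 y `^ q)%:E)))%E).
    apply: le_integral_upper => y /inO y0.
      by rewrite lee_fin mulr_ge0 ?powR_ge0.
    have uy := u0 y y0; have b1 := a10 y y0; have b2 := a20 y y0.
    rewrite -EFinD -EFinM lee_fin -powRM ?(ltW uy)//.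
    apply: (@le_trans _ _ ((C0 * (a1 y + a2 y)) `^ q)).
      apply: ge0_ler_powR; rewrite ?nnegrE ?(ltW q0) ?mulr_ge0 ?addr_ge0 ?(ltW uy) ?(ltW C00)//.
      apply: le_trans (ler_wpM2l (ltW uy) (pointwise y y0)) _.
      by rewrite /a1 /a2 le_eqVlt; apply/orP; left; apply/eqP; ring.
    rewrite [2 * C0]mulrC (powRM _ (ltW C00) (addr_ge0 b1 b2)) (powRM _ (ltW C00))//.
    rewrite -mulrA; apply: ler_wpM2l; first exact: powR_ge0.
    by apply: powR_add_le => //; exact: ltW.
  have -> : Kq * I `^ (q / p) = (4 * (4 * M)) `^ q * (2 * I) `^ (q / p) +
      (4 * (4 * M)) `^ q * (2 * I) `^ (q / p) by rewrite (powRM (q / p) (ler0n R 2) I0) /Kq; ring.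
  apply: (@integral_scaled_sum_le _ _ _ mu O (fun y => a1 y `^ q) (fun y => a2 y `^ q)).
  - exact: measurable_itv.
  - exact: ma1.
  - exact: ma2.
  - by move=> y; exact: powR_ge0.
  - by move=> y; exact: powR_ge0.
  - exact: powR_ge0.
  - exact: I1.
  - exact: I2.
apply: le_trans (gt0_ler_poweR _ _ _ key) _ => //.
- by rewrite invr_ge0 ltW.
- by rewrite in_itv/= leey andbT; apply: integral_ge0 => y _; rewrite lee_fin mulr_ge0 ?powR_ge0.
- by rewrite in_itv/= leey andbT lee_fin !mulr_ge0 ?powR_ge0.
rewrite poweR_EFin lee_fin le_eqVlt; apply/orP; left; apply/eqP.
have C2 : 0 <= 2 * C0 by rewrite mulr_ge0// ltW.
rewrite (powRM _ (powR_ge0 _ _) (mulr_ge0 Kq0 (powR_ge0 _ _))) (powRM _ Kq0 (powR_ge0 _ _)).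
rewrite -!powRrM mulfV ?gt_eqF// (powRr1 C2) mulrA.
by congr (_ * _ `^ _); field; rewrite !gt_eqF.
Qed.

End Sufficiency.

(** * Necessity: a truncated extremal function *)

Section Necessity.
Variable C : R.
Hypothesis C0 : 0 < C.
Hypothesis hC : forall f : R -> R, in_wLp p v f -> struve_dom alpha f ->
  (wnorm q u (struve_transform alpha f) <= C%:E * wnorm p v f)%E.
Variable t : R.
Hypothesis t0 : 0 < t.

Let t20 : 0 < t ^+ 2. Proof. by rewrite exprn_gt0. Qed.
Let tV20 : 0 < t ^- 2. Proof. by rewrite invr_gt0. Qed.
Let k (x : R) : R := x `^ m / (t ^+ 2 + x ^+ 2).
Let k0 x : 0 <= k x. Proof. exact: kernel_ge0. Qed.
Let wt (x : R) : R := (k x * iv x) `^ r.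
(** The extremal function of the duality between k and L_p^v: both k h and
(v h)^p equal wt = (k / v)^r. *)
Let h (x : R) : R := k x `^ (r - 1) * iv x `^ r.
(** On E s the weight v is bounded below and x stays away from 0 and infinity,
so that h is bounded there; E s increases to the half-line. *)
Let E (s : R) := O `&` [set x | expR (- s) <= x <= expR s] `&` [set x | expR (- s) <= v x].
Let f s : R -> R := h \_ (E s).

Let EO s : E s `<=` O. Proof. by move=> x [[]]. Qed.

Let mE s : measurable (E s).
Proof.
rewrite /E -setIA [_ `&` [set x | _ <= v x]]setIC setIA; apply: measurableI.
  by apply: measurable_fun_ler => //; exact: measurable_cst.
have -> : [set x : R | expR (- s) <= x <= expR s] = `[expR (- s), expR s]%classic.
  by apply/seteqP; split => x; rewrite /= in_itv.
exact: measurable_itv.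
Qed.

Let mk : measurable_fun O k. Proof. exact: measurable_kernel. Qed.

Let mh : measurable_fun O h.
Proof. by apply: measurable_funM; exact: measurable_fun_powR. Qed.

Let mwt : measurable_fun O wt.
Proof. by apply: measurable_fun_powR; exact: measurable_funM. Qed.

Let mf s : measurable_fun setT (f s).
Proof. by apply/(measurable_restrictT _ _).1 => //; exact: (measurable_funS _ (EO s) mh). Qed.

Let h0 x : 0 <= h x. Proof. by rewrite mulr_ge0 ?powR_ge0. Qed.
Let f0 s x : 0 <= f s x. Proof. by rewrite /f patchE; case: ifP. Qed.

Let kh x : 0 < x -> k x * h x = wt x.
Proof.
move=> x0; rewrite /h /wt mulrA mulr_powRB1// powRM// ltW//; exact: iv0.
Qed.

Let pr_sum : r + p = p * r.
Proof.
have [_ pr] := conj_expP R p p1; rewrite -/r in pr.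
have -> : p * r = p * r * (p^-1 + r^-1) by rewrite pr mulr1.
by field; rewrite !gt_eqF.
Qed.

Let vh x : 0 < x -> v x `^ p * h x `^ p = wt x.
Proof.
move=> x0; have ix := ltW (iv0 x x0); have vx := v0 x x0.
rewrite /h /wt (powRM _ (powR_ge0 _ _) (powR_ge0 _ _)) (powRM _ (k0 x) ix) -!powRrM.
have -> : (r - 1) * p = r by have := pr_sum; lra.
have -> : r * p = r + p by rewrite pr_sum mulrC.
rewrite powRD_gt0 ?iv0// mulrCA; congr (_ * _).
by rewrite mulrCA -powRM ?(ltW vx)// /iv mulfV ?gt_eqF// powR1 mulr1.
Qed.

Let m0 : 0 < m. Proof. have ha := halpha; rewrite /m; lra. Qed.

Let kmax s := expR s `^ m / t ^+ 2.
Let hmax s := kmax s `^ (r - 1) * expR s `^ r.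

Let kmax_ge0 s : 0 <= kmax s.
Proof. by rewrite divr_ge0 ?powR_ge0// ltW. Qed.

Let bound_k s x : E s x -> k x <= kmax s.
Proof.
move=> [[/inO x0 /= /andP[_ xs]] _].
rewrite /k /kmax; apply: ler_pM; rewrite ?powR_ge0 ?invr_ge0 ?addr_ge0 ?sqr_ge0//.
  by apply: ge0_ler_powR; rewrite ?nnegrE ?(ltW m0) ?(ltW x0) ?expR_ge0.
by rewrite lef_pV2 ?posrE ?lerDl ?sqr_ge0// ltr_wpDr ?sqr_ge0.
Qed.

Let bound_h s x : E s x -> h x <= hmax s.
Proof.
move=> Esx; have := Esx; move=> [[/inO x0 /= _] vs].
apply: ler_pM; rewrite ?powR_ge0//.
  apply: ge0_ler_powR; rewrite ?nnegrE ?subr_ge0 ?(ltW r1)//; exact: bound_k.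
apply: ge0_ler_powR; rewrite ?nnegrE ?(ltW r0) ?expR_ge0 ?(ltW (iv0 x x0))//.
by rewrite -[expR s]invrK lef_pV2 ?posrE ?v0 ?invr_gt0 ?expR_gt0// -expRN.
Qed.

Let finE s : (mu (E s) < +oo)%E.
Proof.
apply: (@le_lt_trans _ _ (mu `[expR (- s), expR s])).
  rewrite le_measure ?inE//; first exact: mE.
  by move=> x [[_ /=]]; rewrite in_itv.
by rewrite /= lebesgue_measure_itv/=; case: ifP => _; rewrite ltry.
Qed.

Let integrable_E s (g : R -> R) (b : R) : measurable_fun O g ->
  (forall x, E s x -> `|g x| <= b) -> mu.-integrable (E s) (EFin \o g).
Proof.
move=> mg gb; apply: measurable_bounded_integrable => //.
- exact: mE.
- exact: finE.
- exact: (measurable_funS _ (EO s) mg).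
- exists b; split; first exact: num_real.
  by move=> N bN x /gb gx; exact: le_trans (ltW bN).
Qed.

Let J s : R := fine (\int[mu]_(x in E s) (wt x)%:E).
Let JE s : (\int[mu]_(x in E s) (wt x)%:E = (J s)%:E)%E.
Proof.
rewrite /J fineK//; apply: integrable_fin_num; first exact: mE.
apply: (integrable_E s wt (kmax s * hmax s)) => // x Esx.
rewrite ger0_norm ?powR_ge0// -kh; last exact/inO/EO/Esx.
by apply: ler_pM => //; [exact: bound_k|exact: bound_h].
Qed.

Let wnorm_f s : wnorm p v (f s) = (J s `^ p^-1)%:E.
Proof.
rewrite /wnorm -poweR_EFin -JE; congr (_ `^ _)%E.
have -> : E s = O `&` E s by rewrite setIidr//; exact: EO.
rewrite integral_mkcondr; apply: eq_integral => x; rewrite inE => /inO x0.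
rewrite /f !patchE; by case: ifP => _; rewrite ?normr0 ?powR0 ?gt_eqF ?mulr0// ger0_norm// vh.
Qed.

Let in_wLp_f s : in_wLp p v (f s).
Proof.
split; first by apply: measurable_funTS; exact: mf.
by rewrite wnorm_f ltry.
Qed.

Let integrable_integrand s y : 0 < y ->
  mu.-integrable (E s) (EFin \o struve_integrand alpha h y).
Proof.
move=> y0; have [c0 [C1 [c00 C10 hk]]] := struve_kernel_bounds alpha halpha.
apply: (integrable_E s _ (C1 * (expR s * y) `^ m * hmax s)).
  apply: measurable_funM.
    apply: measurable_funM => //; apply: measurable_fun_powR.
    by apply: measurable_funTS; exact: measurable_funM.
  apply: (measurable_comp (F := O) (f := struve alpha)) => //.
  - by move=> _ [x /inO x0 <-]; rewrite /= in_itv/= andbT mulr_gt0.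
  - exact: measurable_struve.
  - by apply: measurable_funTS; exact: measurable_funM.
move=> x Esx; have x0 : 0 < x by exact/inO/EO/Esx.
have xy0 : 0 < x * y by exact: mulr_gt0.
have [[_ /= /andP[_ xs]] _] := Esx.
have -> : struve_integrand alpha h y x = (x * y) `^ 2^-1 * struve alpha (x * y) * h x.
  by rewrite /struve_integrand mulrAC.
have /andP[h1 h2] := hk (x * y) xy0.
move: ((x * y) `^ 2^-1 * _) h1 h2 => K h1 h2.
have K0 : 0 <= K.
  apply: le_trans h1; rewrite mulr_ge0 ?(ltW c00)// divr_ge0 ?powR_ge0//.
  by rewrite addr_ge0 ?sqr_ge0.
rewrite normrM (ger0_norm K0) (ger0_norm (h0 x)).
apply: ler_pM => //; last exact: bound_h.
apply: le_trans h2 _; apply: ler_wpM2l; first exact: ltW.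
apply: (@le_trans _ _ ((x * y) `^ m)).
  rewrite ler_pdivrMr; last by rewrite ltr_wpDr ?sqr_ge0.
  by rewrite mulrDr mulr1 lerDl mulr_ge0 ?powR_ge0 ?sqr_ge0.
apply: ge0_ler_powR; rewrite ?nnegrE ?(ltW m0) ?(ltW xy0) ?mulr_ge0 ?expR_ge0 ?(ltW y0)//.
by rewrite ler_wpM2r// ltW.
Qed.

Let integrand_f s y : struve_integrand alpha (f s) y =
  (struve_integrand alpha h y) \_ (E s).
Proof.
apply/funext => x; rewrite patchE /struve_integrand /f patchE.
by case: ifP => // _; rewrite mulr0 mul0r.
Qed.

(** The function f s is supported in x <= exp s, so the partial integrals are
constant for N > exp s. *)
Let transform_f s y : 0 < y -> locally_integrable O (struve_integrand alpha (f s) y) /\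
  struve_partial alpha (f s) y N @[N --> +oo] -->
    (\int[mu]_(x in E s) (struve_integrand alpha h y x)%:E)%E.
Proof.
move=> y0; have iE := integrable_integrand s y y0.
split.
  apply: open_integrable_locally; first exact: interval_open.
  rewrite integrand_f.
  have -> : EFin \o (struve_integrand alpha h y) \_ (E s) =
      (EFin \o struve_integrand alpha h y) \_ (E s).
    by apply/funext => x; rewrite /= !patchE; case: ifP.
  apply: (integrableS measurableT) => //.
  by rewrite -integrable_mkcond//; exact: mE.
apply: cvg_near_cst; near=> N.
have Ns : expR s < N by near: N; apply: nbhs_pinfty_gt; rewrite num_real.
rewrite /struve_partial integrand_f.
have EN : `]0, N[%classic `&` E s = E s.
  apply/setIidr => x Esx; have [[/inO x0 /= /andP[_ xs]] _] := Esx.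
  by rewrite in_itv/= x0 (le_lt_trans xs).
rewrite -[in RHS]EN integral_mkcondr; apply: eq_integral => x _.
by rewrite !patchE; case: ifP.
Unshelve. all: end_near. Qed.

Let JE_ge0 s : 0 <= J s.
Proof. by rewrite fine_ge0// integral_ge0// => x _; rewrite lee_fin powR_ge0. Qed.

Let transformE s y : 0 < y ->
  (struve_transform alpha (f s) y)%:E =
  (\int[mu]_(x in E s) (struve_integrand alpha h y x)%:E)%E.
Proof.
move=> y0; have [_ tf] := transform_f s y y0.
rewrite /struve_transform (cvg_lim _ tf)// fineK//.
by apply: integrable_fin_num (integrable_integrand s y y0); exact: mE.
Qed.

Let struve_dom_f s : struve_dom alpha (f s).
Proof.
move=> y y0; have [lf tf] := transform_f s y y0; split => //.
by exists (struve_transform alpha (f s) y); rewrite transformE.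
Qed.

Section LowerBound.
Variable c : R.
Hypothesis c0 : 0 < c.
Hypothesis hc : forall z, 0 < z ->
  c * (z `^ (alpha + 3 / 2) / (1 + z ^+ 2)) <= z `^ 2^-1 * struve alpha z.

(** The x-factor of the kernel bound is k x, and k h = wt integrates to J s. *)
Let transform_ge s y : 0 < y ->
  c * (y `^ m / (t ^- 2 + y ^+ 2)) * J s <= struve_transform alpha (f s) y.
Proof.
move=> y0; rewrite -lee_fin transformE// EFinM -JE -ge0_integralZl//; last 4 first.
- exact: mE.
- by apply/measurable_EFinP; apply: (measurable_funS _ (EO s) mwt).
- by move=> x _; rewrite lee_fin powR_ge0.
- by rewrite lee_fin mulr_ge0 ?kernel_ge0// ltW.
apply: le_integral_upper => x Esx; have x0 : 0 < x by exact/inO/EO/Esx.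
  by rewrite -EFinM lee_fin (mulr_ge0 (mulr_ge0 (ltW c0) (kernel_ge0 _ y tV20)))// powR_ge0.
have xy0 : 0 < x * y by exact: mulr_gt0.
rewrite -EFinM lee_fin -kh//.
have -> : struve_integrand alpha h y x = (x * y) `^ 2^-1 * struve alpha (x * y) * h x.
  by rewrite /struve_integrand mulrAC.
rewrite [X in X <= _]mulrA; apply: ler_wpM2r => //; apply: le_trans (hc (x * y) xy0).
rewrite -mulrA; apply: ler_wpM2l; first exact: ltW.
rewrite /k (powRM _ (ltW x0) (ltW y0)) mulf_div [y `^ m * _]mulrC.
apply: ler_wpM2l; first by rewrite mulr_ge0 ?powR_ge0.
(* 1 + x^2 y^2 <= (t^-2 + y^2) (t^2 + x^2) *)
rewrite lef_pV2 ?posrE ?mulr_gt0 ?addr_gt0 ?exprn_gt0//.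
rewrite mulrDl !mulrDr mulVf ?gt_eqF// exprMn [y ^+ 2 * x ^+ 2]mulrC.
have : 0 <= t ^- 2 * x ^+ 2 by rewrite mulr_ge0 ?sqr_ge0// ltW.
have : 0 <= y ^+ 2 * t ^+ 2 by rewrite mulr_ge0 ?sqr_ge0.
lra.
Qed.

(** The norm of f s is (J s)^(1/p), while its transform is at least c J s times the
y-factor, which has norm factor u q (t^-2). *)
Let testing s : ((c * J s)%:E * factor u q (t ^- 2) <= (C * J s `^ p^-1)%:E)%E.
Proof.
have cJ : 0 <= c * J s by rewrite mulr_ge0// ltW.
rewrite [X in (_ <= X)%E]EFinM -wnorm_f; apply: le_trans (hC _ (in_wLp_f s) (struve_dom_f s)).
rewrite factorE// /wnorm.
have -> : (c * J s)%:E = (((c * J s) `^ q)%:E `^ q^-1)%E.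
  by rewrite poweR_EFin -powRrM mulfV ?gt_eqF// powRr1.
have ige (D : set R) (g : R -> R) : (0 <= \int[mu]_(x in D) (g x `^ q)%:E)%E.
  by apply: integral_ge0 => x _; rewrite lee_fin powR_ge0.
rewrite -poweRM ?lee_fin ?powR_ge0//.
apply: gt0_ler_poweR; rewrite ?in_itv/= ?leey ?andbT ?mule_ge0 ?lee_fin ?powR_ge0 ?invr_ge0 ?(ltW q0)//.
  by apply: integral_ge0 => x _; rewrite lee_fin mulr_ge0 ?powR_ge0.
rewrite -ge0_integralZl ?lee_fin ?powR_ge0//; last 2 first.
- apply/measurable_EFinP; apply: measurable_fun_powR; apply: measurable_funM => //.
  exact: measurable_kernel.
- by move=> x _; rewrite lee_fin powR_ge0.
apply: le_integral_upper => y /inO y0; first by rewrite -EFinM lee_fin mulr_ge0 ?powR_ge0.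
have uy := u0 y y0; have ky : 0 <= y `^ m / (t ^- 2 + y ^+ 2) by exact: kernel_ge0.
have := le_trans (transform_ge s y y0) (ler_norm _).
move: (y `^ m / _) ky => K ky ge.
have Ku : 0 <= K * u y by rewrite mulr_ge0// ltW.
rewrite -EFinM lee_fin -(powRM _ cJ Ku) -(powRM _ (ltW uy) (normr_ge0 _)).
apply: ge0_ler_powR; rewrite ?nnegrE ?(ltW q0)//; first exact: mulr_ge0.
  by rewrite mulr_ge0// ltW.
rewrite mulrA [u y * _]mulrC; apply: ler_wpM2r; first exact: ltW.
by rewrite mulrAC.
Qed.

(** If the factor with u is finite, dividing testing by (J s)^(1/p) bounds
(J s)^(1/r) uniformly in s; if it is infinite, testing forces J s = 0.  In both
cases monotone convergence along E s bounds the factor with v. *)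
Lemma necessity : (factor u q (t ^- 2) * factor iv r (t ^+ 2) <= (C / c)%:E)%E.
Proof.
set A := factor u q _.
have A0 : (0 < A)%E by exact: factor_gt0.
(* b = (C / c) / A, read as 0 when A is infinite. *)
have [b [b0 bJ Ab]] : exists b : R, [/\ 0 <= b, forall s, J s <= b `^ r &
    (A * b%:E <= (C / c)%:E)%E].
  have := testing; rewrite -/A; case: A A0 => [a| |]//= a0 JA; last first.
    exists 0; split => // [s|]; last by rewrite mule0 lee_fin divr_ge0// ltW.
    rewrite powR0 ?gt_eqF//; have := JA s; rewrite leNgt; apply: contraNle => Js.
    by rewrite gt0_muley ?ltry// lte_fin mulr_gt0.
  rewrite lte_fin in a0; exists (C / c / a); split => [|s|].
  - by rewrite !divr_ge0// ltW.
  - have := JA s; rewrite -EFinM lee_fin.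
    have [->|Jn0] := eqVneq (J s) 0; first by rewrite powR_ge0.
    have Js : 0 < J s by rewrite lt_neqAle eq_sym Jn0 JE_ge0.
    have [_ pr] := conj_expP R p p1; rewrite -/r in pr.
    have {1}-> : J s = J s `^ p^-1 * J s `^ r^-1 by rewrite -powRD_gt0// pr powRr1.
    rewrite mulrCA -[X in X <= _]mulrA mulrC.
    rewrite ler_pM2r ?powR_gt0// => le.
    have {1}-> : J s = (J s `^ r^-1) `^ r by rewrite -powRrM mulVf ?gt_eqF// powRr1.
    apply: ge0_ler_powR; rewrite ?nnegrE ?(ltW r0) ?powR_ge0 ?divr_ge0 ?(ltW C0) ?(ltW c0) ?(ltW a0)//.
    by rewrite ler_pdivlMr// ler_pdivlMr// mulrC mulrA.
  - by rewrite -EFinM lee_fin mulrC divfK// gt_eqF.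
have IO : (\int[mu]_(x in O) (wt x)%:E <= (b `^ r)%:E)%E.
  have -> : O = \bigcup_(s in setT) E s.
    apply/seteqP; split => [x Ox|x [s _ /EO]//].
    have x0 := inO x Ox; have vx := v0 x x0.
    exists (`|ln x| + `|ln (v x)|) => //; rewrite /E; split; first split => //=.
    - rewrite -[X in _ <= X <= _](lnK x0) !ler_expR.
      by rewrite -ler_norml lerDl.
    - rewrite /= -[X in _ <= X](lnK vx) ler_expR.
      by apply: le_trans (lerNnormlW (lexx _)); rewrite lerN2 lerDr.
  have wtO s : (\int[mu]_(x in E s) (wt x)%:E = \int[mu]_(x in E s) ((wt \_ O) x)%:E)%E.
    by apply: eq_integral => x; rewrite inE => /EO Ox; rewrite patchE mem_set.
  rewrite (_ : (\int[mu]_(x in _) _)%E =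
      (\int[mu]_(x in \bigcup_(s in setT) E s) ((wt \_ O) x)%:E)%E); last first.
    apply: eq_integral => x; rewrite inE => -[s _ /EO Ox].
    by rewrite patchE mem_set.
  apply: integral_bigcup_nested_le => [s|s1 s2 s12 x|||//|s _].
  - exact: mE.
  - move=> [[Ox /= /andP[x1 x2]] /= vx]; have e12 : expR (- s2) <= expR (- s1) by rewrite ler_expR lerN2.
    rewrite /E; split; last exact: le_trans vx.
    by split => //=; rewrite (le_trans e12 x1) (le_trans x2)// ler_expR.
  - by apply/measurable_EFinP/(measurable_restrictT _ _).1.
  - by move=> x; rewrite lee_fin patchE; case: ifP => // _; exact: powR_ge0.
  - by rewrite lee_fin powR_ge0.
  - by rewrite -wtO JE lee_fin.
rewrite factorE//.
apply: le_trans Ab; apply: lee_wpmul2l; first exact: ltW.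
have -> : b%:E = ((b `^ r)%:E `^ r^-1)%E by rewrite poweR_EFin -powRrM mulfV ?gt_eqF// powRr1.
apply: gt0_ler_poweR; rewrite ?in_itv/= ?leey ?andbT ?lee_fin ?powR_ge0 ?invr_ge0 ?(ltW r0)//.
by apply: integral_ge0 => x _; rewrite lee_fin powR_ge0.
Qed.

End LowerBound.

End Necessity.
End TwoWeights.

Theorem theorem5p2 (R : realType) (p q alpha : R) (u v : R -> R)
    (hp : 1 < p) (hpq : p <= q) (halpha : 1 / 2 < alpha)
    (hu : weight u) (hv : weight v) :
  (exists2 C : R, 0 < C &
     forall f : R -> R, in_wLp p v f -> struve_dom alpha f ->
       (wnorm q u (struve_transform alpha f) <= C%:E * wnorm p v f)%E)
  <->
  (ereal_sup
     [set ((\int[lebesgue_measure]_(x in `]0%R, +oo[)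
              ((x `^ (alpha + 3 / 2) / (t ^- 2 + x ^+ 2)) `^ q
                 * u x `^ q)%:E) `^ q^-1
           * (\int[lebesgue_measure]_(x in `]0%R, +oo[)
                ((x `^ (alpha + 3 / 2) / (t ^+ 2 + x ^+ 2)) `^ conj_exp p
                   * v x `^ (- conj_exp p))%:E) `^ (conj_exp p)^-1)%E
     | t in `]0%R, +oo[] < +oo)%E.
Proof.
have [[mu_ _ _] u0] := hu; have [[mv _ _] v0] := hv.
have termE t : 0 < t ->
  ((\int[lebesgue_measure]_(x in `]0%R, +oo[)
              ((x `^ (alpha + 3 / 2) / (t ^- 2 + x ^+ 2)) `^ q
                 * u x `^ q)%:E) `^ q^-1
           * (\int[lebesgue_measure]_(x in `]0%R, +oo[)
                ((x `^ (alpha + 3 / 2) / (t ^+ 2 + x ^+ 2)) `^ conj_exp p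
                   * v x `^ (- conj_exp p))%:E) `^ (conj_exp p)^-1)%E =
  (factor alpha u q (t ^- 2) * factor alpha (fun x => (v x)^-1%R) (conj_exp p) (t ^+ 2))%E.
  move=> t0; congr (_ * (_ `^ _))%E; apply: eq_integral => x.
  rewrite inE/= in_itv/= andbT => x0; congr (_ * _)%:E.
  by rewrite -mulN1r powRrM (powR_inv1 (ltW (v0 x x0))).
split=> [[C C0 hC]|].
  have [c [C1 [c0 _ hc]]] := struve_kernel_bounds alpha halpha.
  apply: (@le_lt_trans _ _ (C / c)%:E); last exact: ltry.
  apply: ge_ereal_sup; move=> e [t]; rewrite /= in_itv/= andbT => t0 <-; rewrite termE//.
  apply: (necessity p q alpha u v) => // z z0; by have /andP[] := hc z z0.
set S := (X in ereal_sup X) => Sfin.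
have S0 : (0 <= ereal_sup S)%E.
  apply: (@le_trans _ _ (factor alpha u q (1 ^- 2) *
    factor alpha (fun x => (v x)^-1%R) (conj_exp p) (1 ^+ 2))%E).
    by rewrite mule_ge0// poweR_ge0.
  by apply: ereal_sup_ubound; exists 1; [rewrite /= in_itv/= ltr01|exact: termE].
apply: (sufficiency p q alpha u v _ _ _ _ _ _ _ (fine (ereal_sup S))) => // t t0.
rewrite fineK ?ge0_fin_numE//; apply: ereal_sup_ubound.
by exists t; [rewrite /= in_itv/= t0|exact: termE].
Qed.
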